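(* The $\boxtimes\otimes_h$-bialgebra $(T(\mathcal{NC}),\Delta,\Delta_\prec,\Delta_\succ)$ of words on non-crossing partitions, endowed with the vertical product $\nabla$ induced by the gap-insertion composition, is an unshuffle $\boxtimes\otimes_h$-Hopf algebra.
   Context: All vector spaces are over $\mathbb C$. A collection is a family $(P(n))_{n\ge1}$ of vector spaces; a bicollection is a family $P=(P(n,m))_{n,m\ge 0}$ of vector spaces ($n$ outputs, $m$ inputs); $\mathrm{Coll}_2$ is the category of bicollections, with families of linear maps as morphisms. Horizontal tensor product: $(P\otimes_h Q)(n,m)=\bigoplus_{n_1+n_2=n,\ m_1+m_2=m}P(n_1,m_1)\otimes Q(n_2,m_2)$, with unit $\mathbf 1_h$ ($\mathbf 1_h(0,0)=\mathbb C1_0$, zero otherwise). Vertical tensor product: $(P\boxtimes Q)(n,m)=\bigoplus_{k\ge 0}P(n,k)\otimes Q(k,m)$, with unit $\mathbf 1_v$ ($\mathbf 1_v(n,n)=\mathbb C1_n$, zero for $n\neq m$). Exchange map: $R:(C_1\boxtimes C_2)\otimes_h(C_3\boxtimes C_4)\to(C_1\otimes_h C_3)\boxtimes(C_2\otimes_h C_4)$, $(p^1\boxtimes p^2)\otimes_h(p^3\boxtimes p^4)\mapsto(p^1\otimes_h p^3)\boxtimes(p^2\otimes_h p^4)$. A horizontal algebra is a monoid in $(\mathrm{Coll}_2,\otimes_h,\mathbf 1_h)$; $\mathrm{Alg}_h$ is the category of these. If $(A,m)$ is a horizontal algebra, $A\boxtimes A$ is one with product $m^{\boxtimes}=(m\boxtimes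 m)\circ R_{A,A,A,A}$; $\mathbf 1_v$ is one via $1_n\otimes_h1_m\mapsto 1_{n+m}$. A PROS is a monoid, and a $\boxtimes\otimes_h$-bialgebra a comonoid, in $(\mathrm{Alg}_h,\boxtimes,\mathbf 1_v)$ (all structure maps are horizontal algebra morphisms). A $\boxtimes\otimes_h$-Hopf algebra is a bicollection which is, for the same horizontal algebra structure, both a bialgebra ($\Delta,\varepsilon$) and a PROS ($\nabla,\eta$), together with a horizontal algebra morphism $S$ (antipode) such that $\nabla\circ(S\boxtimes\mathrm{id})\circ\Delta=\nabla\circ(\mathrm{id}\boxtimes S)\circ\Delta=\eta\circ\varepsilon$. No compatibility between $\Delta$ and $\nabla$ is required. A bialgebra $(C,\Delta,\varepsilon)$ is co-nilpotent if: (1) $C(n,n)=\mathbb C1_n$ and $C(0,m)=C(m,0)=0$ for $m\ge1$; (2) $\Delta(1_n)=1_n\boxtimes1_n$, and for $c\in C(n,m)$, $n\ne m$, $\Delta(c)=\Delta^{\mathrm{red}}(c)+1_n\boxtimes c+c\boxtimes1_m$ with $\Delta^{\mathrm{red}}(c)\in\bigoplus_{k\ne n,m}C(n,k)\otimes C(k,m)$; (3) for each $c\in C(n,m)$, $n\neq m$, some iterate of $\Delta^{\mathrm{red}}$ vanishes on $c$. An unshuffle $\boxtimes\otimes_h$-bialgebra is a co-nilpotent $\boxtimes\otimes_h$-bialgebra $\bar C=C\oplus\mathbf 1_v$ (with $C(n,n)=0$), with horizontal product $m$, coproduct $\Delta$, and a splitting $\Delta^{\mathrm{red}}=\Delta_\prec+\Delta_\succ$,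 $\Delta_\prec,\Delta_\succ:C\to C\boxtimes C$, satisfying $(\Delta_\prec\boxtimes I)\Delta_\prec=(I\boxtimes\Delta^{\mathrm{red}})\Delta_\prec$, $(\Delta_\succ\boxtimes I)\Delta_\prec=(I\boxtimes\Delta_\prec)\Delta_\succ$, $(\Delta^{\mathrm{red}}\boxtimes I)\Delta_\succ=(I\boxtimes\Delta_\succ)\Delta_\succ$, and, with $\Delta^+_\prec(c)=\Delta_\prec(c)+c\boxtimes1_m$ and $\Delta^+_\succ(c)=\Delta_\succ(c)+1_n\boxtimes c$ for $c\in C(n,m)$: $\Delta\circ m=m^\boxtimes\circ(\Delta\otimes_h\Delta)$; for $p,q\in C$, $\Delta^+_\prec(m(p\otimes_h q))=m^\boxtimes(\Delta^+_\prec(p)\otimes_h\Delta(q))$ and $\Delta^+_\succ(m(p\otimes_h q))=m^\boxtimes(\Delta^+_\succ(p)\otimes_h\Delta(q))$; and for $q\in C$, $r\ge0$, $\Delta^+_\bullet(m(1_r\otimes_h q))=m^\boxtimes((1_r\boxtimes1_r)\otimes_h\Delta^+_\bullet(q))$ for $\bullet\in\{\prec,\succ\}$. (In the case below $m(C\otimes_h C)\subset C$.) An unshuffle $\boxtimes\otimes_h$-Hopf algebra is a $\boxtimes\otimes_h$-Hopf algebra whose underlying bialgebra is an unshuffle $\boxtimes\otimes_h$-bialgebra. For a collection $P$, $T(P)$ is the bicollection of words: $T(P)(0,0)=\mathbb C1$ and $T(P)(n,m)=\bigoplus_{k_1+\cdots+k_n=m}P(k_1)\otimes\cdots\otimes P(k_n)$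 otherwise; horizontal product is concatenation. $\mathrm{NC}(n)$ is the set of non-crossing partitions of $\{1,\dots,n\}$, $\mathrm{NC}(0)=\{\emptyset\}$; $\mathcal{NC}(n)$ is the vector space spanned by $\mathrm{NC}(n-1)$, $n\ge1$. A partition $\pi$ of $p$ elements has $|\pi|=p+1$ inputs, its gaps (before $1$, between consecutive elements, after $p$); the gap-insertion composition $\pi\circ(\alpha_1,\dots,\alpha_{|\pi|})$ inserts $\alpha_i$ in the $i$-th gap of $\pi$; the unit is the empty partition $\emptyset$. $\nabla((p^1\cdots p^n)\boxtimes(q_1\cdots q_N))$, $N=\sum_i|p^i|$, is the word whose $i$-th letter is $p^i$ composed with its consecutive group of $|p^i|$ letters $q_j$; $\eta(1_n)=\emptyset^n$. The counit $\varepsilon$ is the horizontal morphism with $\varepsilon(\emptyset)=1_1$, $\varepsilon(\pi)=0$ for $\pi\ne\emptyset$. A block $W$ is nested in a block $V\neq W$ of $\pi$ if $W\subset\{\min V,\dots,\max V\}$. A lowerset of $\pi$ is a (possibly empty) set $L$ of blocks such that if $V\in L$ then all blocks in which $V$ is nested are in $L$. If $L$ partitions $p$ elements, it is identified (after renumbering) with an element of $\mathrm{NC}(p)$; the remaining blocks lie in the gaps of $L$ and define a word $U=U_0\cdots U_p$ of (possibly empty) non-crossing partitions with $\pi=L\circ(U_0,\dots,U_p)$. The pair $(L,U)$ is a cut of $\pi$; $1\in L$ means that the block of $\pi$ containing $1$ is in $L$, and $1\in U$ means it is not. $\Delta$ is the horizontal algebra morphism with $\Delta(\pi)=\sum_{(L,U)\in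 cut(\pi)}L\boxtimes U$. For non-empty $\pi$, $\Delta^+_\prec(\pi)=\sum_{1\in L}L\boxtimes U$ and $\Delta^+_\succ(\pi)=\sum_{1\in U}L\boxtimes U$ (sums over cuts), extended to words with at least one non-empty letter by $\Delta^+_\bullet(\emptyset^q\,\pi\,w)=(\emptyset^q\boxtimes\emptyset^q)\,\Delta^+_\bullet(\pi)\,\Delta(w)$ for $\pi\ne\emptyset$, $w$ any word, $q\ge0$; and $\Delta_\prec(w)=\Delta^+_\prec(w)-w\boxtimes\emptyset^m$, $\Delta_\succ(w)=\Delta^+_\succ(w)-\emptyset^n\boxtimes w$ for such words $w\in T(\mathcal{NC})(n,m)$. *)

(* Defs.v *)
From HB Require Import structures.
From mathcomp Require Import all_boot all_order all_algebra finmap.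
From mathcomp Require Import boolp reals complex.
From mathcomp Require Import monalg.

Set Implicit Arguments.
Unset Strict Implicit.
Unset Printing Implicit Defensive.

Import Order.TTheory GRing.Theory.

Local Open Scope ring_scope.

Declare Scope bicoll_scope.
Delimit Scope bicoll_scope with bic.

(** * Bicollections

   Every vector space over a field has a basis, so a bicollection
   (P(n,m))_{n,m} is given here by a bigraded basis: a type of basis elements,
   each with a number of outputs and of inputs.  Then [vect K P] is the direct
   sum of all the P(n,m), the subspace P(n,m) is [homog n m], and a family of
   linear maps P(n,m) -> Q(n,m) is a linear map [vect K P -> vect K Q]
   preserving both degrees ([bimorphism]). *)

Record bicoll := Bicoll {
  basis :> choiceType;
  outp : basis -> nat;
  inp : basis -> nat }.
Arguments Bicoll : clear implicits.
Bind Scope bicoll_scope with bicoll.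

Notation vect K P := {malg K[basis P%bic]}.

Section LinearExtension.
Variable K : fieldType.

Definition lin_ext (X : choiceType) (V : lmodType K) (f : X -> V)
    (u : {malg K[X]}) : V :=
  \sum_(x <- msupp u) u@_x *: f x.

Definition homog (P : bicoll) (n m : nat) (u : vect K P) : Prop :=
  {in msupp u, forall x, outp x = n /\ inp x = m}.

Definition bimorphism (P Q : bicoll) (f : vect K P -> vect K Q) : Prop :=
  linear f /\ forall n m u, homog n m u -> homog n m (f u).

End LinearExtension.

(** ** Horizontal and vertical tensor products

   The tensor product of two spaces with bases X and Y has basis X * Y. *)

Definition hprod (P Q : bicoll) : bicoll :=
  Bicoll (P * Q)%type
    (fun x => outp x.1 + outp x.2)%N (fun x => inp x.1 + inp x.2)%N.

Definition vprod (P Q : bicoll) : bicoll :=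
  Bicoll {x : P * Q | inp x.1 == outp x.2}
    (fun x => outp (val x).1) (fun x => inp (val x).2).

Notation "P ⊗ Q" := (hprod P Q) (at level 40, left associativity) : bicoll_scope.
Notation "P ⊠ Q" := (vprod P Q) (at level 40, left associativity) : bicoll_scope.

Definition unit_h : bicoll := Bicoll unit (fun=> 0%N) (fun=> 0%N).

Definition unit_v : bicoll := Bicoll nat id id.

Section Tensors.
Variable K : fieldType.
Implicit Types P Q : bicoll.

Definition hten P Q (u : vect K P) (v : vect K Q) : vect K (P ⊗ Q) :=
  lin_ext (fun x => lin_ext (fun y => << ((x, y) : (P ⊗ Q)%bic) >>) v) u.

(* For u in P(n,k) and v in Q(k,m) this is the tensor of u and v.  In general
   the terms which cannot be composed vertically are discarded. *)
Definition vten P Q (u : vect K P) (v : vect K Q) : vect K (P ⊠ Q) :=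
  lin_ext (fun x => lin_ext (fun y =>
    if insub (x, y) is Some z then << (z : (P ⊠ Q)%bic) >> else 0) v) u.

End Tensors.

Notation "u ⊗ v" := (hten u v) (at level 40, left associativity) : ring_scope.
Notation "u ⊠ v" := (vten u v) (at level 40, left associativity) : ring_scope.

Section TensorMaps.
Variable K : fieldType.
Implicit Types P Q R : bicoll.

Definition hmap P Q P' Q' (f : vect K P -> vect K P')
    (g : vect K Q -> vect K Q') : vect K (P ⊗ Q) -> vect K (P' ⊗ Q') :=
  lin_ext (fun x : (P ⊗ Q)%bic => f << x.1 >> ⊗ g << x.2 >>).

Definition vmap P Q P' Q' (f : vect K P -> vect K P')
    (g : vect K Q -> vect K Q') : vect K (P ⊠ Q) -> vect K (P' ⊠ Q') :=
  lin_ext (fun x : (P ⊠ Q)%bic => f << (val x).1 >> ⊠ g << (val x).2 >>).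

Definition hassoc P Q R : vect K (P ⊗ Q ⊗ R) -> vect K (P ⊗ (Q ⊗ R)) :=
  lin_ext (fun x : (P ⊗ Q ⊗ R)%bic =>
    << x.1.1 >> ⊗ (<< x.1.2 >> ⊗ << x.2 >>)).

Definition hlunit P : vect K (unit_h ⊗ P) -> vect K P :=
  lin_ext (fun x : (unit_h ⊗ P)%bic => << x.2 >>).

Definition hrunit P : vect K (P ⊗ unit_h) -> vect K P :=
  lin_ext (fun x : (P ⊗ unit_h)%bic => << x.1 >>).

Definition vassoc P Q R : vect K (P ⊠ Q ⊠ R) -> vect K (P ⊠ (Q ⊠ R)) :=
  lin_ext (fun x : (P ⊠ Q ⊠ R)%bic =>
    << (val (val x).1).1 >> ⊠ (<< (val (val x).1).2 >> ⊠ << (val x).2 >>)).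

Definition vlunit P : vect K (unit_v ⊠ P) -> vect K P :=
  lin_ext (fun x : (unit_v ⊠ P)%bic => << (val x).2 >>).

Definition vrunit P : vect K (P ⊠ unit_v) -> vect K P :=
  lin_ext (fun x : (P ⊠ unit_v)%bic => << (val x).1 >>).

Definition exchange P1 P2 P3 P4 :
    vect K ((P1 ⊠ P2) ⊗ (P3 ⊠ P4)) -> vect K ((P1 ⊗ P3) ⊠ (P2 ⊗ P4)) :=
  lin_ext (fun x : ((P1 ⊠ P2) ⊗ (P3 ⊠ P4))%bic =>
    (<< (val x.1).1 >> ⊗ << (val x.2).1 >>) ⊠
    (<< (val x.1).2 >> ⊗ << (val x.2).2 >>)).

End TensorMaps.

(** * Horizontal algebras *)

Record halg (K : fieldType) := HAlg {
  hcar :> bicoll;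
  hmul : vect K (hcar ⊗ hcar) -> vect K hcar;
  hunit : vect K unit_h -> vect K hcar }.
Arguments HAlg : clear implicits.
Arguments hmul {K} h _.
Arguments hunit {K} h _.

Section HorizontalAlgebras.
Variable K : fieldType.
Implicit Types A B : halg K.

Record is_halg A : Prop := IsHAlg {
  hmul_bimorphism : bimorphism (hmul A);
  hunit_bimorphism : bimorphism (hunit A);
  hmul_assoc :
    hmul A \o hmap (hmul A) id =1
    hmul A \o hmap id (hmul A) \o @hassoc K A A A;
  hmul_unitl : hmul A \o hmap (hunit A) id =1 @hlunit K A;
  hmul_unitr : hmul A \o hmap id (hunit A) =1 @hrunit K A }.

Definition hmorphism A B (f : vect K A -> vect K B) : Prop :=
  [/\ bimorphism f,
      f \o hmul A =1 hmul B \o hmap f f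
    & f \o hunit A =1 hunit B].

Definition vprod_alg A B : halg K :=
  HAlg K (A ⊠ B)
    (vmap (hmul A) (hmul B) \o @exchange K A B A B)
    (lin_ext (fun x : unit_h => hunit A << x >> ⊠ hunit B << x >>)).

Definition unit_v_alg : halg K :=
  HAlg K unit_v
    (lin_ext (fun x : (unit_v ⊗ unit_v)%bic => << ((x.1 + x.2)%N : unit_v) >>))
    (lin_ext (fun _ : unit_h => << (0%N : unit_v) >>)).

End HorizontalAlgebras.
Arguments unit_v_alg {K}.

(** * Bialgebras, PROS, Hopf algebras *)

Section HopfAlgebras.
Variable K : fieldType.
Variable A : halg K.

Record is_bialgebra (Delta : vect K A -> vect K (A ⊠ A))
    (eps : vect K A -> vect K unit_v) : Prop := IsBialgebra {
  bialg_halg : is_halg A;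
  Delta_hmorphism : @hmorphism K A (vprod_alg A A) Delta;
  eps_hmorphism : @hmorphism K A unit_v_alg eps;
  Delta_coassoc :
    @vassoc K A A A \o vmap Delta id \o Delta =1 vmap id Delta \o Delta;
  Delta_counitl : @vlunit K A \o vmap eps id \o Delta =1 id;
  Delta_counitr : @vrunit K A \o vmap id eps \o Delta =1 id }.

Record is_pros (nabla : vect K (A ⊠ A) -> vect K A)
    (eta : vect K unit_v -> vect K A) : Prop := IsPros {
  pros_halg : is_halg A;
  nabla_hmorphism : @hmorphism K (vprod_alg A A) A nabla;
  eta_hmorphism : @hmorphism K unit_v_alg A eta;
  nabla_assoc :
    nabla \o vmap nabla id =1 nabla \o vmap id nabla \o @vassoc K A A A;
  nabla_unitl : nabla \o vmap eta id =1 @vlunit K A;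
  nabla_unitr : nabla \o vmap id eta =1 @vrunit K A }.

Record is_hopf (Delta : vect K A -> vect K (A ⊠ A))
    (eps : vect K A -> vect K unit_v)
    (nabla : vect K (A ⊠ A) -> vect K A)
    (eta : vect K unit_v -> vect K A)
    (S : vect K A -> vect K A) : Prop := IsHopf {
  hopf_bialgebra : is_bialgebra Delta eps;
  hopf_pros : is_pros nabla eta;
  S_hmorphism : hmorphism S;
  S_antipodel : nabla \o vmap S id \o Delta =1 eta \o eps;
  S_antipoder : nabla \o vmap id S \o Delta =1 eta \o eps }.

End HopfAlgebras.

(** * Co-nilpotent and unshuffle bialgebras

   The co-nilpotent bialgebra is [A] itself, the direct sum of C and of the
   lines spanned by the elements [one n] = 1_n; so C is the sum of the A(n,m)
   with n <> m.  Maps C -> C ⊠ C are represented by their extension by 0 to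
   the diagonal part of [A]. *)

Section Unshuffle.
Variable K : fieldType.

Definition offdiag (P : bicoll) (u : vect K P) : Prop :=
  {in msupp u, forall x, outp x != inp x}.

Definition offdiag2 (P : bicoll) (u : vect K (P ⊠ P)) : Prop :=
  {in msupp u, forall x, outp (val x).1 != inp (val x).1 /\
                         outp (val x).2 != inp (val x).2}.

Fixpoint vpow (P : bicoll) (k : nat) : bicoll :=
  if k is k'.+1 then (vpow P k' ⊠ P)%bic else P.

Fixpoint iter_coprod (P : bicoll) (d : vect K P -> vect K (P ⊠ P)) (k : nat) :
    vect K P -> vect K (vpow P k) :=
  if k is k'.+1 then vmap (iter_coprod d k') id \o d else id.

Variable A : halg K.
Variable Delta : vect K A -> vect K (A ⊠ A).
Variable eps : vect K A -> vect K unit_v.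
Variable one : nat -> vect K A.

Definition red_coprod : vect K A -> vect K (A ⊠ A) :=
  lin_ext (fun x : A =>
    if outp x == inp x then 0
    else Delta << x >> - one (outp x) ⊠ << x >> - << x >> ⊠ one (inp x)).

Record is_conilpotent : Prop := IsConilpotent {
  conil_bialgebra : is_bialgebra Delta eps;
  one_homog : forall n, homog n n (one n);
  one_neq0 : forall n, one n != 0;
  one_span : forall n u, homog n n u -> exists c : K, u = c *: one n;
  no_input : forall n (u : vect K A), (0 < n)%N -> homog n 0 u -> u = 0;
  no_output : forall m (u : vect K A), (0 < m)%N -> homog 0 m u -> u = 0;
  Delta_one : forall n, Delta (one n) = one n ⊠ one n;
  red_coprod_offdiag : forall u, offdiag u -> offdiag2 (red_coprod u);
  red_coprod_nilpotent : forall n m u, n != m -> homog n m u ->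
    exists k, iter_coprod red_coprod k.+1 u = 0 }.

Definition is_half_coprod (d : vect K A -> vect K (A ⊠ A)) : Prop :=
  [/\ bimorphism d,
      forall u, offdiag u -> offdiag2 (d u)
    & forall n u, homog n n u -> d u = 0].

Variables dprec dsucc : vect K A -> vect K (A ⊠ A).

Definition dprec_plus : vect K A -> vect K (A ⊠ A) :=
  lin_ext (fun x : A => dprec << x >> + << x >> ⊠ one (inp x)).

Definition dsucc_plus : vect K A -> vect K (A ⊠ A) :=
  lin_ext (fun x : A => dsucc << x >> + one (outp x) ⊠ << x >>).

Local Notation vmul := (hmul (vprod_alg A A)).
Local Notation dred := red_coprod.

Record is_unshuffle : Prop := IsUnshuffle {
  unsh_conilpotent : is_conilpotent;
  dprec_half : is_half_coprod dprec;
  dsucc_half : is_half_coprod dsucc;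
  unsh_split : forall c, offdiag c -> dred c = dprec c + dsucc c;
  unsh_prec_prec : forall c, offdiag c ->
    vassoc (vmap dprec id (dprec c)) = vmap id dred (dprec c);
  unsh_succ_prec : forall c, offdiag c ->
    vassoc (vmap dsucc id (dprec c)) = vmap id dprec (dsucc c);
  unsh_succ_succ : forall c, offdiag c ->
    vassoc (vmap dred id (dsucc c)) = vmap id dsucc (dsucc c);
  unsh_mul_closed : forall p q : vect K A, offdiag p -> offdiag q ->
    offdiag (hmul A (p ⊗ q));
  unsh_Delta_mul : forall u, Delta (hmul A u) = vmul (hmap Delta Delta u);
  unsh_prec_mul : forall p q : vect K A, offdiag p -> offdiag q ->
    dprec_plus (hmul A (p ⊗ q)) = vmul (dprec_plus p ⊗ Delta q);
  unsh_succ_mul : forall p q : vect K A, offdiag p -> offdiag q ->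
    dsucc_plus (hmul A (p ⊗ q)) = vmul (dsucc_plus p ⊗ Delta q);
  unsh_prec_one : forall r q, offdiag q ->
    dprec_plus (hmul A (one r ⊗ q)) =
    vmul ((one r ⊠ one r) ⊗ dprec_plus q);
  unsh_succ_one : forall r q, offdiag q ->
    dsucc_plus (hmul A (one r ⊗ q)) =
    vmul ((one r ⊠ one r) ⊗ dsucc_plus q) }.

Definition is_unshuffle_hopf (nabla : vect K (A ⊠ A) -> vect K A)
    (eta : vect K unit_v -> vect K A) (S : vect K A -> vect K A) : Prop :=
  is_hopf Delta eps nabla eta S /\ is_unshuffle.

End Unshuffle.

(** * Words on a collection

   As for bicollections, a collection (P(n))_{n >= 1} is given by a basis. *)

Record coll := Coll {
  letters :> choiceType;
  arity : letters -> nat;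
  arity_gt0 : forall p, (0 < arity p)%N }.
Arguments Coll : clear implicits.

Definition words (P : coll) : bicoll :=
  Bicoll (seq P) size (fun w => sumn [seq arity p | p <- w]).

Section Words.
Variable K : fieldType.
Variable P : coll.

Definition words_alg : halg K :=
  HAlg K (words P)
    (lin_ext (fun x : (words P ⊗ words P)%bic => << (x.1 ++ x.2 : words P) >>))
    (lin_ext (fun _ : unit_h => << ([::] : words P) >>)).

(* The horizontal algebra morphism on words with prescribed values on letters. *)
Definition words_ext (A : halg K) (f : P -> vect K A) :
    vect K (words P) -> vect K A :=
  lin_ext (fun w : words P =>
    foldr (fun p u => hmul A (f p ⊗ u)) (hunit A << (tt : unit_h) >>) w).

End Words.

(** * Non-crossing partitions *)

Local Open Scope fset_scope.
Local Open Scope nat_scope.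

Definition points (pi : {fset {fset nat}}) : {fset nat} :=
  \bigcup_(V <- pi) V.

Definition interval (n : nat) : {fset nat} := [fset x in iota 1 n].

Record is_nc (n : nat) (pi : {fset {fset nat}}) : Prop := IsNC {
  nc_nonempty : forall V, V \in pi -> V != fset0;
  nc_disjoint : forall V W, V \in pi -> W \in pi -> V != W -> [disjoint V & W];
  nc_cover : points pi = interval n;
  nc_noncrossing : forall V W a b c d, V \in pi -> W \in pi -> V != W ->
    a \in V -> c \in V -> b \in W -> d \in W -> ~ [/\ a < b, b < c & c < d] }.

(* The disjoint union over n of the sets NC(n). *)
Definition ncpart : choiceType := {x : nat * {fset {fset nat}} | `[< is_nc x.1 x.2 >]}.

Definition npoints (pi : ncpart) : nat := (val pi).1.
Definition blocks (pi : ncpart) : {fset {fset nat}} := (val pi).2.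

Lemma ncpartP (pi : ncpart) : is_nc (npoints pi) (blocks pi).
Proof. by apply/asboolP; exact: (valP pi). Qed.

Definition MkNC n pi (H : is_nc n pi) : ncpart := Sub (n, pi) (introT (asboolP _) H).

Lemma interval0 : interval 0 = fset0.
Proof. by apply/fsetP => x; rewrite !inE. Qed.

Lemma is_nc0 : is_nc 0 fset0.
Proof.
split=> [V|V W||V W a b c d]; rewrite ?inE //.
by rewrite interval0 /points big_seq_fset0.
Qed.

Definition nc0 : ncpart := MkNC is_nc0.

(* The position of x in the increasing enumeration, from 1, of the set A. *)
Definition rank (A : {fset nat}) (x : nat) : nat := #|` [fset y in A | y <= x]|.

Definition renumber (pi : {fset {fset nat}}) : {fset {fset nat}} :=
  [fset [fset rank (points pi) x | x in V : {fset nat}] | V in pi].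

Lemma pointsP (pi : {fset {fset nat}}) x :
  reflect (exists2 V, V \in pi & x \in V) (x \in points pi).
Proof.
apply: (iffP (bigfcupP _ _ _ _)) => [[V]|[V Vpi xV]]; rewrite ?andbT.
  by exists V.
by exists V; rewrite ?andbT.
Qed.

Lemma rank_lt (A : {fset nat}) x y :
  y \in A -> x < y -> rank A x < rank A y.
Proof.
move=> yA xy; apply: fproper_ltn_card; rewrite fproperEneq; apply/andP; split.
  apply/eqP => /fsetP /(_ y); rewrite !inE yA leqnn /= => /esym.
  by rewrite leqNgt xy.
by apply/fsubsetP => z; rewrite !inE => /andP[-> zx]; exact: (leq_trans zx (ltnW xy)).
Qed.

Lemma rank_mono (A : {fset nat}) x y : x \in A -> y \in A ->
  (rank A x < rank A y) = (x < y).
Proof.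
move=> xA yA; case: (ltngtP x y) => [xy|yx|->]; last by rewrite ltnn.
  exact: rank_lt.
by apply/negbTE; rewrite -leqNgt ltnW // rank_lt.
Qed.

Lemma rank_inj (A : {fset nat}) : {in A &, injective (rank A)}.
Proof.
move=> x y xA yA e; case: (ltngtP x y) => // [xy|yx].
  by have := rank_lt yA xy; rewrite e ltnn.
by have := rank_lt xA yx; rewrite e ltnn.
Qed.

Lemma rank_img (A : {fset nat}) : [fset rank A x | x in A] = interval #|` A|.
Proof.
apply/eqP; rewrite eqEfcard; apply/andP; split.
  apply/fsubsetP => z /imfsetP[/= x xA ->]; rewrite !inE mem_iota add1n ltnS.
  apply/andP; split; last first.
    by apply: fsubset_leq_card; apply/fsubsetP => y; rewrite !inE => /andP[].
  rewrite cardfs_gt0; apply/fset0Pn; exists x; by rewrite !inE xA leqnn.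
have -> : #|` [fset rank A x | x in A]| = #|` A|.
  by apply: card_in_imfset => x y xA yA; exact: rank_inj.
by rewrite card_fseq undup_id ?iota_uniq ?size_iota.
Qed.

Lemma points_renumber pi : points (renumber pi) = interval #|` points pi|.
Proof.
rewrite -rank_img; apply/fsetP => z; apply/pointsP/imfsetP.
  move=> [V /imfsetP[/= W Wpi ->] /imfsetP[/= x xW ->]].
  by exists x => //; apply/pointsP; exists W.
move=> [/= x /pointsP[W Wpi xW] ->].
exists [fset rank (points pi) y | y in W]; last by apply/imfsetP; exists x.
by apply/imfsetP; exists W.
Qed.

Lemma is_nc_renumber n pi (rho : {fset {fset nat}}) :
  is_nc n pi -> rho `<=` pi -> is_nc #|` points rho| (renumber rho).
Proof.
move=> [ne dj _ nx] /fsubsetP sub.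
have inP V x : V \in rho -> x \in V -> x \in points rho.
  by move=> VP xV; apply/pointsP; exists V.
split=> [_ /imfsetP[/= V VP ->]|_ _ /imfsetP[/= V VP ->] /imfsetP[/= W WP ->]||].
- have /fset0Pn[x xV] := ne V (sub _ VP).
  by apply/fset0Pn; exists (rank (points rho) x); apply/imfsetP; exists x.
- move=> nVW; have VW : V != W by apply: contra nVW => /eqP->.
  apply/fdisjointP => _ /imfsetP[/= x xV ->]; apply/imfsetP => -[/= y yW].
  move=> /rank_inj e; have exy : x = y by apply: e; [exact: inP xV | exact: inP yW].
  have /fdisjointP /(_ x xV) := dj V W (sub _ VP) (sub _ WP) VW.
  by rewrite exy yW.
- exact: points_renumber.
- move=> _ _ a b c d /imfsetP[/= V VP ->] /imfsetP[/= W WP ->] nVW.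
  have VW : V != W by apply: contra nVW => /eqP->.
  move=> /imfsetP[/= a' aV ->] /imfsetP[/= c' cV ->].
  move=> /imfsetP[/= b' bW ->] /imfsetP[/= d' dW ->].
  have := nx V W a' b' c' d' (sub _ VP) (sub _ WP) VW aV cV bW dW.
  by rewrite !rank_mono //; [exact: inP cV| exact: inP dW | exact: inP bW
    | exact: inP cV | exact: inP aV | exact: inP bW].
Qed.

Lemma sub_blocks pi (P : pred {fset nat}) : [fset V in blocks pi | P V] `<=` blocks pi.
Proof. by apply/fsubsetP => V; rewrite !inE => /andP[]. Qed.

Definition sub_ncpart (pi : ncpart) (P : pred {fset nat}) : ncpart :=
  MkNC (is_nc_renumber (ncpartP pi) (sub_blocks pi P)).

(* The gaps of a partition of n elements are numbered from 0 to n.  After the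
   insertion of alpha_0, ..., alpha_n in these gaps, the element i of the
   partition becomes [offset alpha i] and the element t of alpha_i becomes
   [offset alpha i + t]. *)
Definition offset (alpha : seq ncpart) (i : nat) : nat :=
  i + \sum_(j < i) npoints (nth nc0 alpha j).

Definition gap_insert_npoints (pi : ncpart) (alpha : seq ncpart) : nat :=
  npoints pi + \sum_(j < (npoints pi).+1) npoints (nth nc0 alpha j).

Definition gap_insert_blocks (pi : ncpart) (alpha : seq ncpart) :
    {fset {fset nat}} :=
  [fset [fset offset alpha x | x in V : {fset nat}] | V in blocks pi] `|`
  \bigcup_(i <- iota 0 (npoints pi).+1)
    [fset [fset (offset alpha i + t)%N | t in V : {fset nat}]
      | V in blocks (nth nc0 alpha i)].

Lemma offsetS alpha i :
  offset alpha i.+1 = (offset alpha i + npoints (nth nc0 alpha i)).+1.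
Proof. by rewrite /offset big_ord_recr /= addSn addnA. Qed.

Lemma offset_lt alpha i j :
  i < j -> offset alpha i + npoints (nth nc0 alpha i) < offset alpha j.
Proof.
elim: j => // j IH; rewrite ltnS leq_eqVlt => /predU1P[<-|/IH lt_ij].
  by rewrite offsetS.
by rewrite offsetS ltnS; apply: leq_trans (ltnW lt_ij) (leq_addr _ _).
Qed.

Lemma offset_lt_lex alpha i j s t :
  s <= npoints (nth nc0 alpha i) -> t <= npoints (nth nc0 alpha j) ->
  (offset alpha i + s < offset alpha j + t) = (i < j) || (i == j) && (s < t).
Proof.
move=> si tj; case: (ltngtP i j) => [ij|ji|->] /=; last by rewrite ltn_add2l.
  apply: leq_ltn_trans (leq_trans (offset_lt alpha ij) (leq_addr _ _)).
  by rewrite leq_add2l.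
apply/negbTE; rewrite -leqNgt.
apply: leq_trans (leq_trans (ltnW (offset_lt alpha ji)) (leq_addr _ _)).
by rewrite leq_add2l.
Qed.

Lemma offset_inj alpha i j s t :
  s <= npoints (nth nc0 alpha i) -> t <= npoints (nth nc0 alpha j) ->
  offset alpha i + s = offset alpha j + t -> i = j /\ s = t.
Proof.
move=> si tj e.
have := offset_lt_lex si tj; have := offset_lt_lex tj si.
by rewrite e ltnn; case: (ltngtP i j) => [//|//|<-] /=; case: (ltngtP s t).
Qed.

Lemma block_bounds pi V x : V \in blocks pi -> x \in V -> 0 < x <= npoints pi.
Proof.
move=> VP xV; have : x \in points (blocks pi) by apply/pointsP; exists V.
by rewrite (nc_cover (ncpartP pi)) !inE mem_iota add1n ltnS.
Qed.

Lemma block_of pi x : 0 < x <= npoints pi -> exists2 V, V \in blocks pi & x \in V.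
Proof.
move=> xn; apply/pointsP; rewrite (nc_cover (ncpartP pi)) !inE mem_iota.
by rewrite add1n ltnS.
Qed.

Lemma gap_insert_blocksP pi alpha V :
  reflect ((exists2 W, W \in blocks pi & V = [fset offset alpha x | x in W]) \/
     exists i W, [/\ i <= npoints pi, W \in blocks (nth nc0 alpha i)
        & V = [fset (offset alpha i + t)%N | t in W]])
    (V \in gap_insert_blocks pi alpha).
Proof.
rewrite inE; apply: (iffP orP) => -[].
- by move=> /imfsetP[/= W WP ->]; left; exists W.
- case/bigfcupP => i; rewrite andbT mem_iota add0n ltnS => /= ile.
  by move=> /imfsetP[/= W WP ->]; right; exists i, W.
- by move=> [W WP ->]; left; apply/imfsetP; exists W.
- move=> [i [W [ile WP ->]]]; right; apply/bigfcupP; exists i.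
    by rewrite andbT mem_iota add0n ltnS.
  by apply/imfsetP; exists W.
Qed.

(* Every block of the result consists of elements [offset alpha i + t]. *)
Lemma gap_insert_decomp pi alpha x :
  0 < x <= gap_insert_npoints pi alpha ->
  exists i t, [/\ i <= npoints pi, t <= npoints (nth nc0 alpha i)
                & x = offset alpha i + t].
Proof.
have -> : gap_insert_npoints pi alpha = (offset alpha (npoints pi).+1).-1 by [].
move=> /andP[_]; elim: (npoints pi) => [|n IH]; rewrite offsetS /= => xle.
  exists 0, x; split => //; first by move: xle; rewrite /offset big_ord0.
  by rewrite /offset big_ord0.
case: (leqP (offset alpha n.+1) x) => [le_x|].
  exists n.+1, (x - offset alpha n.+1); split; rewrite ?subnKC //.
  by rewrite leq_subLR.
rewrite offsetS ltnS => xle'.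
by have [|i [t [ile tle ->]]] := IH; [rewrite offsetS | exists i, t; split; rewrite ?(leqW ile)].
Qed.

Lemma is_nc_gap_insert pi alpha :
  is_nc (gap_insert_npoints pi alpha) (gap_insert_blocks pi alpha).
Proof.
have [ne dj cv nx] := ncpartP pi.
have ca i := ncpartP (nth nc0 alpha i).
have bd i W t : W \in blocks (nth nc0 alpha i) -> t \in W ->
    0 < t /\ t <= npoints (nth nc0 alpha i).
  by move=> WP tW; apply/andP; exact: block_bounds WP tW.
have addE i : offset alpha i = offset alpha i + 0 by rewrite addn0.
split.
- move=> V /gap_insert_blocksP[[W WP ->]|[i [W [_ WP ->]]]].
    have /fset0Pn[x xW] := ne W WP.
    by apply/fset0Pn; exists (offset alpha x); apply/imfsetP; exists x.
  have /fset0Pn[x xW] := nc_nonempty (ca i) WP.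
  by apply/fset0Pn; exists (offset alpha i + x); apply/imfsetP; exists x.
- move=> V V' /gap_insert_blocksP[[W WP ->]|[i [W [_ WP ->]]]];
    move=> /gap_insert_blocksP[[W' WP' ->]|[j [W' [_ WP' ->]]]] nVV;
    apply/fdisjointP => _ /imfsetP[/= x xW ->]; apply/imfsetP => -[/= y yW].
  + have nW : W != W' by apply: contra nVV => /eqP->.
    rewrite (addE x) (addE y) => /offset_inj[] // exy _; subst y.
    by have /fdisjointP /(_ x xW) := dj W W' WP WP' nW; rewrite yW.
  + have [y0 yle] := bd _ _ _ WP' yW.
    by rewrite (addE x) => /offset_inj[] // _ e; rewrite -e in y0.
  + have [x0 xle] := bd _ _ _ WP xW.
    by rewrite (addE y) => /offset_inj[] // _ e; rewrite e in x0.
  + have [x0 xle] := bd _ _ _ WP xW; have [y0 yle] := bd _ _ _ WP' yW.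
    move=> /offset_inj[] // eij exy; subst j y.
    have nW : W != W' by apply: contra nVV => /eqP->.
    by have /fdisjointP /(_ x xW) := nc_disjoint (ca i) WP WP' nW; rewrite yW.
- apply/fsetP => x; rewrite !inE mem_iota add1n ltnS; apply/pointsP/idP.
    have Nle i t : i <= npoints pi -> t <= npoints (nth nc0 alpha i) ->
        offset alpha i + t <= gap_insert_npoints pi alpha.
      move=> ile tle; rewrite -ltnS.
      have -> : (gap_insert_npoints pi alpha).+1 = offset alpha (npoints pi).+1 by [].
      by apply: leq_ltn_trans (offset_lt alpha (_ : i < _)); rewrite ?leq_add2l.
    move=> [V /gap_insert_blocksP[[W WP ->]|[i [W [ile WP ->]]]]].
      move=> /imfsetP[/= y yW ->].
      have /andP[y0 yle] := block_bounds WP yW.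
      rewrite (addE y) Nle // andbT addn0.
      by apply: leq_trans y0 (leq_addr _ _).
    move=> /imfsetP[/= t tW ->]; have [t0 tle] := bd _ _ _ WP tW.
    by rewrite Nle // andbT (leq_trans t0) // leq_addl.
  move=> xN; have [i [t [ile tle ex]]] := gap_insert_decomp xN.
  case: (posnP t) => [t0|t0].
    have i0 : 0 < i.
      move: xN; rewrite ex t0 addn0; case: (i) => //.
      by rewrite /offset big_ord0.
    have [|V VP iV] := @block_of pi i; first by rewrite i0.
    exists [fset offset alpha y | y in V].
      by apply/gap_insert_blocksP; left; exists V.
    by apply/imfsetP; exists i => //; rewrite ex t0 addn0.
  have [|V VP tV] := @block_of (nth nc0 alpha i) t; first by rewrite t0.
  exists [fset (offset alpha i + y)%N | y in V].
    by apply/gap_insert_blocksP; right; exists i, V.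
  by apply/imfsetP; exists t.
- move=> V V' a b c d.
  move=> /gap_insert_blocksP[[W WP ->]|[i [W [_ WP ->]]]];
    move=> /gap_insert_blocksP[[W' WP' ->]|[j [W' [_ WP' ->]]]] nVV;
    move=> /imfsetP[/= a' aW ->] /imfsetP[/= c' cW ->];
    move=> /imfsetP[/= b' bW ->] /imfsetP[/= d' dW ->].
  + have nW : W != W' by apply: contra nVV => /eqP->.
    rewrite (addE a') (addE b') (addE c') (addE d') !offset_lt_lex //.
    rewrite !ltnn !andbF !orbF.
    exact: nx WP WP' nW aW cW bW dW.
  + have [? ble] := bd _ _ _ WP' bW; have [? dle] := bd _ _ _ WP' dW.
    rewrite (addE a') (addE c') !offset_lt_lex // => -[_ lbc lcd].
    move: lbc; rewrite ltn0 andbF orbF => jc; move: lcd.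
    by rewrite ltnNge (ltnW jc) /= (gtn_eqF jc).
  + have [? ale] := bd _ _ _ WP aW; have [? cle] := bd _ _ _ WP cW.
    rewrite (addE b') (addE d') !offset_lt_lex // => -[lab lbc _].
    move: lab; rewrite ltn0 andbF orbF => ib; move: lbc.
    by rewrite ltnNge (ltnW ib) /= (gtn_eqF ib).
  + have [? ale] := bd _ _ _ WP aW; have [? cle] := bd _ _ _ WP cW.
    have [? ble] := bd _ _ _ WP' bW; have [? dle] := bd _ _ _ WP' dW.
    rewrite !offset_lt_lex //; case: (ltngtP i j) => [ij|ji|eij] /=; [by move=> []|by move=> []|].
    subst j; have nW : W != W' by apply: contra nVV => /eqP->.
    exact: (nc_noncrossing (ca i)) WP WP' nW aW cW bW dW.
Qed.

(* The composition of pi with alpha_0, ..., alpha_n, where n = npoints pi; it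
   is meant for alpha of size n + 1. *)
Definition gap_insert (pi : ncpart) (alpha : seq ncpart) : ncpart :=
  MkNC (is_nc_gap_insert pi alpha).

Definition NC : coll := Coll ncpart (fun pi => (npoints pi).+1) (fun=> isT).

(** ** Cuts *)

Definition block_max (V : {fset nat}) : nat := \max_(x <- V) x.

Definition block_min (V : {fset nat}) : nat :=
  \big[minn/block_max V]_(x <- V) x.

Definition nested (W V : {fset nat}) : bool :=
  (W != V) && all (fun x => block_min V <= x <= block_max V) W.

Definition lowerset (pi : ncpart) (L : {fset {fset nat}}) : bool :=
  all (fun V => all (fun W => nested V W ==> (W \in L)) (blocks pi)) L.

Definition lowersets (pi : ncpart) : seq {fset {fset nat}} :=
  [seq L <- fpowerset (blocks pi) | lowerset pi L].

Definition cut_low (pi : ncpart) (L : {fset {fset nat}}) : ncpart :=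
  sub_ncpart pi (fun V => V \in L).

(* A block outside a lowerset L lies in the i-th gap of L when exactly i of the
   points of L precede each of its elements. *)
Definition in_gap (L : {fset {fset nat}}) (i : nat) (W : {fset nat}) : bool :=
  all (fun x => #|` [fset y in points L | y < x]| == i) W.

Definition cut_up (pi : ncpart) (L : {fset {fset nat}}) : seq ncpart :=
  [seq sub_ncpart pi (fun W => (W \notin L) && in_gap L i W)
     | i <- iota 0 #|` points L|.+1].

(** * The operations on words of non-crossing partitions *)

Section NCHopf.
Variable K : fieldType.
Local Open Scope ring_scope.

Local Notation TNC := (words NC).
Local Notation TNCalg := (words_alg K NC).
Local Notation word w := << (w : TNC) >>.
Local Notation vmul := (hmul (vprod_alg TNCalg TNCalg)).

Definition nc_one (n : nat) : vect K TNC := word (nseq n nc0).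

Definition cut_tensor (pi : ncpart) (L : {fset {fset nat}}) : vect K (TNC ⊠ TNC) :=
  word [:: cut_low pi L] ⊠ word (cut_up pi L).

Definition nc_coprod : vect K TNC -> vect K (TNC ⊠ TNC) :=
  @words_ext K NC (vprod_alg TNCalg TNCalg)
    (fun pi : ncpart => \sum_(L <- lowersets pi) cut_tensor pi L).

Definition nc_counit : vect K TNC -> vect K unit_v :=
  @words_ext K NC unit_v_alg
    (fun pi : ncpart => if pi == nc0 then << (1%N : unit_v) >> else 0).

Definition nc_nabla : vect K (TNC ⊠ TNC) -> vect K TNC :=
  lin_ext (fun x : (TNC ⊠ TNC)%bic =>
    let p := (val x).1 in let q := (val x).2 in
    word [seq gap_insert pq.1 pq.2
           | pq <- zip p (reshape [seq arity (pi : NC) | pi <- p] q)]).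

Definition nc_eta : vect K unit_v -> vect K TNC :=
  lin_ext (fun n : unit_v => nc_one n).

(* The block of 1 belongs to L exactly when 1 is one of the points of L. *)
Definition nc_prec_plus_letter (pi : ncpart) : vect K (TNC ⊠ TNC) :=
  \sum_(L <- lowersets pi | 1%N \in points L) cut_tensor pi L.

Definition nc_succ_plus_letter (pi : ncpart) : vect K (TNC ⊠ TNC) :=
  \sum_(L <- lowersets pi | 1%N \notin points L) cut_tensor pi L.

(* The value 0 on the words without non-empty letter is a convention. *)
Definition nc_half_plus (d : ncpart -> vect K (TNC ⊠ TNC)) :
    vect K TNC -> vect K (TNC ⊠ TNC) :=
  lin_ext (fun w : TNC =>
    let q := find (fun pi => pi != nc0) w in
    if drop q w is pi :: w' then
      vmul (vmul ((nc_one q ⊠ nc_one q) ⊗ d pi) ⊗ nc_coprod (word w'))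
    else 0).

Definition nc_prec_plus := nc_half_plus nc_prec_plus_letter.
Definition nc_succ_plus := nc_half_plus nc_succ_plus_letter.

Definition nc_prec : vect K TNC -> vect K (TNC ⊠ TNC) :=
  lin_ext (fun w : TNC =>
    if all (fun pi => pi == nc0) w then 0
    else nc_prec_plus (word w) - word w ⊠ nc_one (inp w)).

Definition nc_succ : vect K TNC -> vect K (TNC ⊠ TNC) :=
  lin_ext (fun w : TNC =>
    if all (fun pi => pi == nc0) w then 0
    else nc_succ_plus (word w) - nc_one (outp w) ⊠ word w).

End NCHopf.

(* Main.v *)
Require Import Defs.
From HB Require Import structures.
From mathcomp Require Import all_boot all_order all_algebra finmap.
From mathcomp Require Import boolp reals complex.
From mathcomp Require Import monalg zify.

(** Gap insertion and cuts are dual to each other: the cuts (L, U) of a word w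
    are exactly the pairs of composable words with L ∘ U = w ([cutsP]).  So the
    two sides of each coassociativity relation are sums over the triples with
    (x ∘ y) ∘ z = x ∘ (y ∘ z) = w, and only the conditions on the triples have to
    be compared.  The condition "1 ∈ U" says that the first non-empty letter of U
    has the same position as the first non-empty letter of w, and the position
    for L ∘ U is the minimum of the positions for L and U ([find_gap_inserts]);
    the half-coassociativity relations thus become identities about minima.
    Finally L ∘ U = w makes the convolution of maps that are diagonal on words a
    convolution of scalars, so the antipode is S(w) = s(w) w, where s is
    multiplicative on words and is the convolution inverse of the constant 1. *)

Set Implicit Arguments.
Unset Strict Implicit.
Unset Printing Implicit Defensive.

Import Order.TTheory GRing.Theory.

Local Open Scope ring_scope.

(** * Linear extensions and tensor products *)

(** Blocks and nesting serve only to build the dictionary between lowersets and insertions. Its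
    harder half is that a cut reassembles to π. For this a block outside L must lie in a single gap
    of L, and [block_in_gap] is the one step that exploits non-crossing and the closure of L under
    enclosing blocks. After that, [offset] undoes [rank], because a position is found by counting
    points of L and points of gaps ([rank_decomp]).

    For words the main invariant is [inw w - size w], the total number of points. It is additive
    under composition, since [inw a = size b] for composable a and b, and it vanishes exactly on the
    words of empty partitions. It identifies the diagonal part, bounds the iterates of the reduced
    coproduct and makes the recursion for s terminate.

    That recursion yields a left inverse of any multiplicative function with value 1 on the empty
    partition. It can therefore be applied to s itself, and this is what makes s a two-sided
    inverse. *)

Lemma comp_apply A B C (f : B -> C) (g : A -> B) x : (f \o g) x = f (g x).
Proof. by []. Qed.

Section LinearExtension.
Variable K : fieldType.

(** The structure maps are bare functions with [linear] as a separate fact, so the bundled linear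
    map is rebuilt inside the proof. *)
Lemma linear_big (U W : lmodType K) (F : U -> W) : linear F ->
  forall I (r : seq I) (P : pred I) E,
  F (\sum_(i <- r | P i) E i) = \sum_(i <- r | P i) F (E i).
Proof.
move=> linF I r P E.
pose aF := GRing.isLinear.Build K U W *:%R F linF.
pose F' : {linear U -> W} := HB.pack F aF.
by rewrite -[F]/(F' : _ -> _) linear_sum.
Qed.

Lemma linear_scale (U W : lmodType K) (F : U -> W) : linear F ->
  forall a u, F (a *: u) = a *: F u.
Proof.
move=> linF a u.
pose aF := GRing.isLinear.Build K U W *:%R F linF.
pose F' : {linear U -> W} := HB.pack F aF.
by rewrite -[F]/(F' : _ -> _) linearZ.
Qed.

Section Universal.
Variables (X : choiceType) (V : lmodType K).
Implicit Types (f g : X -> V) (u : {malg K[X]}).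

Lemma lin_extEw f u (d : {fset X}) : (msupp u `<=` d)%fset ->
  lin_ext f u = \sum_(x <- d) u@_x *: f x.
Proof.
move=> le; rewrite /lin_ext (big_fset_incl _ le) // => x _ /mcoeff_outdom ->.
by rewrite scale0r.
Qed.

Lemma lin_ext_is_linear f : linear (lin_ext f).
Proof.
move=> a u v; pose d := (msupp u `|` msupp v)%fset.
have uv : (msupp (a *: u + v) `<=` d)%fset.
  apply: fsubset_trans (msuppD_le _ _) _.
  by apply: fsetSU; apply: msuppZ_le.
rewrite (lin_extEw f uv) (lin_extEw f (fsubsetUl _ _ : (msupp u `<=` d)%fset)).
rewrite (lin_extEw f (fsubsetUr _ _ : (msupp v `<=` d)%fset)) scaler_sumr.
rewrite -big_split; apply: eq_bigr => x _ /=.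
by rewrite mcoeffD mcoeffZ scalerDl scalerA.
Qed.

HB.instance Definition _ f :=
  GRing.isLinear.Build K {malg K[X]} V *:%R (lin_ext f) (lin_ext_is_linear f).

Lemma lin_extU f x : lin_ext f << x >> = f x.
Proof. by rewrite /lin_ext msuppU oner_eq0 big_seq_fset1 mcoeffUU scale1r. Qed.

Lemma malg_lin_ext u : u = \sum_(x <- msupp u) u@_x *: << x >>.
Proof.
rewrite [LHS]monalgE; apply: eq_bigr => x _; apply/malgP => y.
by rewrite mcoeffZ !mcoeffU mulrnAr mulr1.
Qed.

Lemma linear_on_basis (F : {malg K[X]} -> V) : linear F ->
  forall u, F u = \sum_(x <- msupp u) u@_x *: F << x >>.
Proof.
move=> linF u; rewrite {1}[u]malg_lin_ext (linear_big linF).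
by apply: eq_bigr => x _; rewrite (linear_scale linF).
Qed.

Lemma eq_linear (F G : {malg K[X]} -> V) : linear F -> linear G ->
  (forall x, F << x >> = G << x >>) -> F =1 G.
Proof.
move=> linF linG FG u; rewrite (linear_on_basis linF) (linear_on_basis linG).
by apply: eq_bigr => x _; rewrite FG.
Qed.

End Universal.

Lemma linear_comp (U V W : lmodType K) (G : V -> W) (F : U -> V) :
  linear G -> linear F -> linear (G \o F).
Proof. by move=> linG linF a u v /=; rewrite linF linG. Qed.

Lemma linear_comp3 (U V W X : lmodType K) (H : W -> X) (G : V -> W) (F : U -> V) :
  linear H -> linear G -> linear F -> linear (H \o G \o F).
Proof. by move=> linH linG linF; do 2![apply: linear_comp => //]. Qed.

Lemma linear_id (U : lmodType K) : linear (@id U).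
Proof. by []. Qed.

(** Restricting to the support matters for off-diagonal vectors: many identities hold on non-trivial
    words only. *)
Lemma eq_linear_supp (X : choiceType) (V : lmodType K) (F G : {malg K[X]} -> V)
    (u : {malg K[X]}) :
  linear F -> linear G -> {in msupp u, forall x, F << x >> = G << x >>} ->
  F u = G u.
Proof.
move=> linF linG FG; rewrite (linear_on_basis linF) (linear_on_basis linG).
by apply: eq_big_seq => x xu; rewrite FG.
Qed.

End LinearExtension.

(** * Homogeneous and off-diagonal vectors *)

Section Homogeneous.
Variable K : fieldType.
Implicit Types P Q : bicoll.

Lemma homogU P (x : P) n m : outp x = n -> inp x = m ->
  homog n m (<< x >> : vect K P).
Proof. by move=> <- <- y; rewrite msuppU oner_eq0 inE => /eqP->. Qed.

Lemma homog0 P n m : homog n m (0 : vect K P).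
Proof. by move=> y; rewrite msupp0 inE. Qed.

Lemma homogD P n m (u v : vect K P) :
  homog n m u -> homog n m v -> homog n m (u + v).
Proof.
move=> hu hv x /(fsubsetP (msuppD_le _ _)); rewrite inE => /orP[]; first exact: hu.
exact: hv.
Qed.

Lemma homogZ P n m a (u : vect K P) : homog n m u -> homog n m (a *: u).
Proof. by move=> hu x /(fsubsetP (msuppZ_le _ _)); exact: hu. Qed.

Lemma homog_sum P n m I (r : seq I) (p : pred I) (E : I -> vect K P) :
  (forall i, p i -> homog n m (E i)) -> homog n m (\sum_(i <- r | p i) E i).
Proof. by move=> hE; elim/big_ind: _ => //; [exact: homog0 | exact: homogD]. Qed.

Lemma homog_sum_seq P n m (I : eqType) (r : seq I) (p : pred I) (E : I -> vect K P) :
  (forall i, i \in r -> p i -> homog n m (E i)) ->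
  homog n m (\sum_(i <- r | p i) E i).
Proof.
by move=> hE; rewrite big_seq_cond; apply: homog_sum => i /andP[]; exact: hE.
Qed.

Lemma bimorphism_lin_ext P Q (f : P -> vect K Q) :
  (forall x, homog (outp x) (inp x) (f x)) ->
  bimorphism (lin_ext f : vect K P -> vect K Q).
Proof.
move=> hf; split; first exact: lin_ext_is_linear.
move=> n m u hu; apply: homog_sum_seq => x xu _; apply: homogZ.
by have [<- <-] := hu x xu.
Qed.

Lemma eq_bimorphism P Q (f g : vect K P -> vect K Q) :
  f =1 g -> bimorphism g -> bimorphism f.
Proof. by move/funext->. Qed.

Lemma offdiagZ P a (u : vect K P) : offdiag u -> offdiag (a *: u).
Proof. by move=> ou x /(fsubsetP (msuppZ_le _ _)); exact: ou. Qed.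

Lemma offdiag_sum P (I : eqType) (r : seq I) (E : I -> vect K P) :
  (forall i, i \in r -> offdiag (E i)) -> offdiag (\sum_(i <- r) E i).
Proof.
move=> hE; rewrite big_seq.
elim/big_ind: _ => // [|u v hu hv] x; first by rewrite msupp0.
by move/(fsubsetP (msuppD_le _ _)); rewrite inE => /orP[/hu|/hv].
Qed.

Lemma offdiag2_sum P (I : eqType) (r : seq I) (p : pred I) (E : I -> vect K (P ⊠ P)) :
  (forall i, i \in r -> p i -> offdiag2 (E i)) ->
  offdiag2 (\sum_(i <- r | p i) E i).
Proof.
move=> hE; rewrite big_seq_cond.
elim/big_ind: _ => // [|u v hu hv|i /andP[]] x; first by rewrite msupp0.
  by move/(fsubsetP (msuppD_le _ _)); rewrite inE => /orP[/hu|/hv].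
exact: hE.
Qed.

End Homogeneous.

(** * Tensor products and structure maps on basis elements *)

Section Tensors.
Variable K : fieldType.
Implicit Types P Q R : bicoll.

Lemma lin_ext_linearl (X : choiceType) (U V : lmodType K) (f : X -> U -> V)
    (w : {malg K[X]}) :
  (forall x, linear (f x)) -> linear (fun u => lin_ext (f^~ u) w).
Proof.
move=> lin_f a u v; rewrite /lin_ext scaler_sumr -big_split.
by apply: eq_bigr => x _ /=; rewrite lin_f scalerDr !scalerA mulrC.
Qed.

Lemma hten_linearl P Q (v : vect K Q) :
  linear (fun u : vect K P => u ⊗ v).
Proof. exact: lin_ext_is_linear. Qed.

Lemma hten_linearr P Q (u : vect K P) : linear (hten u : vect K Q -> _).
Proof. by apply: lin_ext_linearl => x; apply: lin_ext_is_linear. Qed.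

Lemma vten_linearl P Q (v : vect K Q) :
  linear (fun u : vect K P => u ⊠ v).
Proof. exact: lin_ext_is_linear. Qed.

Lemma vten_linearr P Q (u : vect K P) : linear (vten u : vect K Q -> _).
Proof. by apply: lin_ext_linearl => x; apply: lin_ext_is_linear. Qed.

Lemma htenU P Q (x : P) (y : Q) :
  << x >> ⊗ << y >> = << ((x, y) : (P ⊗ Q)%bic) >> :> vect K _.
Proof. by rewrite /hten !lin_extU. Qed.

Lemma vtenU P Q (x : P) (y : Q) : << x >> ⊠ << y >> =
  (if insub (x, y) is Some z then << (z : (P ⊠ Q)%bic) >> else 0) :> vect K _.
Proof. by rewrite /vten !lin_extU. Qed.

Lemma vtenU_val P Q (z : (P ⊠ Q)%bic) :
  << (val z).1 >> ⊠ << (val z).2 >> = << z >> :> vect K _.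
Proof. by rewrite vtenU -surjective_pairing valK. Qed.

Lemma vtenU0 P Q (x : P) (y : Q) : inp x != outp y ->
  << x >> ⊠ << y >> = 0 :> vect K _.
Proof. by move=> /negbTE xy; rewrite vtenU insubF. Qed.

Lemma vtenU_homog P Q (x : P) (y : Q) n m : outp x = n -> inp y = m ->
  homog n m (<< x >> ⊠ << y >> : vect K _).
Proof.
move=> <- <-; rewrite vtenU; case: insubP => [z _ ez|_]; last exact: homog0.
by apply: homogU; rewrite /= ez.
Qed.

Lemma vten_suml P Q I (r : seq I) (p : pred I) (E : I -> vect K P) (v : vect K Q) :
  (\sum_(i <- r | p i) E i) ⊠ v = \sum_(i <- r | p i) (E i ⊠ v).
Proof. exact: (linear_big (vten_linearl v)). Qed.

Lemma vten_sumr P Q I (r : seq I) (p : pred I) (u : vect K P) (E : I -> vect K Q) :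
  u ⊠ (\sum_(i <- r | p i) E i) = \sum_(i <- r | p i) (u ⊠ E i).
Proof. exact: (linear_big (vten_linearr u)). Qed.

Lemma vten0l P Q (v : vect K Q) : (0 : vect K P) ⊠ v = 0.
Proof. exact: linear0. Qed.

Lemma vtenZl P Q a (u : vect K P) (v : vect K Q) : (a *: u) ⊠ v = a *: (u ⊠ v).
Proof. exact: linearZ. Qed.

Lemma vtenZr P Q a (u : vect K P) (v : vect K Q) : u ⊠ (a *: v) = a *: (u ⊠ v).
Proof. exact: (linear_scale (vten_linearr u)). Qed.

Lemma vten0r P Q (u : vect K P) : u ⊠ (0 : vect K Q) = 0.
Proof. by rewrite -(scale0r 0) vtenZr scale0r. Qed.

Lemma hten_suml P Q I (r : seq I) (p : pred I) (E : I -> vect K P) (v : vect K Q) :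
  (\sum_(i <- r | p i) E i) ⊗ v = \sum_(i <- r | p i) (E i ⊗ v).
Proof. exact: (linear_big (hten_linearl v)). Qed.

Lemma hten_sumr P Q I (r : seq I) (p : pred I) (u : vect K P) (E : I -> vect K Q) :
  u ⊗ (\sum_(i <- r | p i) E i) = \sum_(i <- r | p i) (u ⊗ E i).
Proof. exact: (linear_big (hten_linearr u)). Qed.

Lemma hten0l P Q (v : vect K Q) : (0 : vect K P) ⊗ v = 0.
Proof. exact: linear0. Qed.

Lemma hten0r P Q (u : vect K P) : u ⊗ (0 : vect K Q) = 0.
Proof. by rewrite -(scale0r 0) (linear_scale (hten_linearr u)) scale0r. Qed.

Lemma htenZl P Q a (u : vect K P) (v : vect K Q) : (a *: u) ⊗ v = a *: (u ⊗ v).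
Proof. exact: linearZ. Qed.

Lemma htenZr P Q a (u : vect K P) (v : vect K Q) : u ⊗ (a *: v) = a *: (u ⊗ v).
Proof. exact: (linear_scale (hten_linearr u)). Qed.

Lemma hmapU P Q P' Q' (f : vect K P -> vect K P') (g : vect K Q -> vect K Q') x y :
  hmap f g << ((x, y) : (P ⊗ Q)%bic) >> = f << x >> ⊗ g << y >>.
Proof. by rewrite /hmap lin_extU. Qed.

(** If the degrees do not match, the left side is 0 while arbitrary f and g could still make the
    right side non-zero. *)
Lemma vmapU P Q P' Q' (f : vect K P -> vect K P') (g : vect K Q -> vect K Q')
    (x : P) (y : Q) : inp x = outp y ->
  vmap f g (<< x >> ⊠ << y >>) = f << x >> ⊠ g << y >>.
Proof.
move=> /eqP xy; rewrite vtenU; case: insubP => [z _ ez|]; last by rewrite /= xy.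
by rewrite /vmap lin_extU ez.
Qed.

(** A mismatch of degrees in either place makes both sides 0, so the rule can be applied under a sum
    without checking degrees. *)
Lemma vassocU P Q R (x : P) (y : Q) (z : R) :
  vassoc ((<< x >> ⊠ << y >>) ⊠ << z >>)
  = << x >> ⊠ (<< y >> ⊠ << z >>) :> vect K _.
Proof.
case: (eqVneq (inp x) (outp y)) => [exy|nxy]; last first.
  rewrite vtenU0 // vten0l /vassoc linear0 [<< y >> ⊠ _]vtenU.
  case: insubP => [t _ et|_]; last by rewrite vten0r.
  by rewrite vtenU0 //= et.
rewrite [<< x >> ⊠ << y >>]vtenU; case: insubP => [t _ et|]; last by rewrite /= exy eqxx.
case: (eqVneq (inp y) (outp z)) => [eyz|nyz]; last first.
  rewrite (@vtenU0 _ _ y z) // vtenU0 /= ?et // /vassoc linear0.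
  by rewrite vten0r.
rewrite (@vtenU (P ⊠ Q) R t z); case: insubP => [s _ es|]; last by rewrite /= et eyz eqxx.
by rewrite /vassoc lin_extU es /= et.
Qed.

Lemma exchangeU P1 P2 P3 P4 (a : P1) (b : P2) (c : P3) (d : P4) :
  inp a = outp b -> inp c = outp d ->
  exchange ((<< a >> ⊠ << b >>) ⊗ (<< c >> ⊠ << d >>))
  = (<< a >> ⊗ << c >>) ⊠ (<< b >> ⊗ << d >>) :> vect K _.
Proof.
move=> ab cd; rewrite !vtenU; case: insubP => [s _ es|]; last by rewrite /= ab eqxx.
case: insubP => [t _ et|]; last by rewrite /= cd eqxx.
by rewrite htenU /exchange lin_extU /= es et.
Qed.

Lemma vlunitU P n (y : P) : n = outp y ->
  vlunit (<< (n : unit_v) >> ⊠ << y >>) = << y >> :> vect K P.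
Proof.
move=> ny; rewrite vtenU; case: insubP => [z _ ez|]; last by rewrite /= ny eqxx.
by rewrite /vlunit lin_extU ez.
Qed.

Lemma vrunitU P n (x : P) : inp x = n ->
  vrunit (<< x >> ⊠ << (n : unit_v) >>) = << x >> :> vect K P.
Proof.
move=> nx; rewrite vtenU; case: insubP => [z _ ez|]; last by rewrite /= nx eqxx.
by rewrite /vrunit lin_extU ez.
Qed.

Lemma eq_linear_vten (P Q : bicoll) (V : lmodType K) (F G : vect K (P ⊠ Q) -> V) :
  linear F -> linear G ->
  (forall x y, inp x = outp y ->
     F (<< x >> ⊠ << y >>) = G (<< x >> ⊠ << y >>)) -> F =1 G.
Proof.
move=> linF linG FG; apply: eq_linear => // z.
by rewrite -vtenU_val; apply: FG; apply/eqP; exact: (valP z).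
Qed.

Lemma eq_linear_hten (P Q : bicoll) (V : lmodType K) (F G : vect K (P ⊗ Q) -> V) :
  linear F -> linear G ->
  (forall x y, F (<< x >> ⊗ << y >>) = G (<< x >> ⊗ << y >>)) -> F =1 G.
Proof.
by move=> linF linG FG; apply: eq_linear => // -[x y]; rewrite -htenU.
Qed.

Lemma hmap_hten (P Q P' Q' : bicoll) (f : vect K P -> vect K P')
    (g : vect K Q -> vect K Q') x y :
  hmap f g (<< x >> ⊗ << y >>) = f << x >> ⊗ g << y >>.
Proof. by rewrite htenU hmapU. Qed.

Lemma vten_basis (P Q : bicoll) (z : (P ⊠ Q)%bic) : exists x y,
  inp x = outp y /\ << z >> = << x >> ⊠ << y >> :> vect K _.
Proof.
exists (val z).1, (val z).2; split; first by apply/eqP; exact: (valP z).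
by rewrite vtenU_val.
Qed.

Lemma basis_vten (P Q : bicoll) (x : P) (y : Q) : inp x = outp y ->
  exists z : (P ⊠ Q)%bic, << z >> = << x >> ⊠ << y >> :> vect K _
    /\ (outp z = outp x /\ inp z = inp y).
Proof.
move=> /eqP xy; rewrite vtenU; case: insubP => [z _ ez|]; last by rewrite /= xy.
exists z; split=> //.
by rewrite /outp /inp /= ez.
Qed.

Lemma vlunit_linear (P : bicoll) : linear (@vlunit K P).
Proof. exact: lin_ext_is_linear. Qed.

Lemma vrunit_linear (P : bicoll) : linear (@vrunit K P).
Proof. exact: lin_ext_is_linear. Qed.

End Tensors.

(** * Gap insertion and cuts of non-crossing partitions *)

Section GapInsertion.
Local Open Scope fset_scope.
Local Open Scope nat_scope.
Implicit Types (A V W : {fset nat}) (pi lam : ncpart) (b c ups : seq ncpart).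

Lemma ncpart_eq pi lam :
  npoints pi = npoints lam -> blocks pi = blocks lam -> pi = lam.
Proof.
move=> en eb; apply: val_inj.
by rewrite [LHS]surjective_pairing [RHS]surjective_pairing; congr pair.
Qed.

Lemma npoints_eq0 pi : (npoints pi == 0) = (pi == nc0).
Proof.
apply/eqP/eqP => [n0|-> //]; apply: ncpart_eq => //.
apply/fsetP => V; rewrite inE; apply/negP => VP.
have /fset0Pn[x xV] := nc_nonempty (ncpartP pi) VP.
by have := block_bounds VP xV; rewrite n0; case: x {xV}.
Qed.

Lemma imfset_comp_in (X Y Z : choiceType) (f : Y -> Z) (g : X -> Y) (h : X -> Z)
    (U : {fset X}) :
  {in U, forall x, f (g x) = h x} ->
  [fset f y | y in [fset g x | x in U]] = [fset h x | x in U].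
Proof.
move=> fgh; apply/fsetP => z; apply/imfsetP/imfsetP.
  by move=> [/= _ /imfsetP[/= x xU ->] ->]; exists x; rewrite ?fgh.
move=> [/= x xU ->]; exists (g x); rewrite ?fgh //.
by apply/imfsetP; exists x.
Qed.

Lemma imfset_id_in (X : choiceType) (f : X -> X) (U : {fset X}) :
  {in U, forall x, f x = x} -> [fset f x | x in U] = U.
Proof.
move=> fU; apply/fsetP => z; apply/imfsetP/idP.
  by move=> [/= x xU ->]; rewrite fU.
by move=> zU; exists z; rewrite ?fU.
Qed.

Lemma imfset_compK (X Y : choiceType) (f : Y -> X) (g : X -> Y) (U : {fset X}) :
  {in U, cancel g f} -> [fset f y | y in [fset g x | x in U]] = U.
Proof. by move=> gfU; rewrite (imfset_comp_in (h := id)) ?imfset_id_in. Qed.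

Lemma offset0 b : offset b 0 = 0.
Proof. by rewrite /offset big_ord0. Qed.

Lemma npoints_gap_insertS (x : ncpart) b : (npoints (gap_insert x b)).+1 = offset b (npoints x).+1.
Proof. by []. Qed.

Lemma offset_cons y b i : offset (y :: b) i.+1 = (npoints y).+1 + offset b i.
Proof.
rewrite /offset big_ord_recl /=.
rewrite (eq_bigr (fun j : 'I_i => npoints (nth nc0 b j))) //; lia.
Qed.

Lemma offset_sumn b i : i <= size b ->
  offset b i = sumn (take i [seq arity (y : NC) | y <- b]).
Proof.
elim: b i => [|y b IH] [|i] //=; rewrite ?offset0 // ltnS => /IH <-.
exact: offset_cons.
Qed.

Lemma gap_decomp (x : ncpart) b g : g <= npoints (gap_insert x b) ->
  exists i t, [/\ i <= npoints x, t <= npoints (nth nc0 b i)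
                & g = offset b i + t].
Proof.
case: g => [_|g gle]; first by exists 0, 0; rewrite offset0.
exact: gap_insert_decomp.
Qed.

Lemma gap_insert_nc0 (x : ncpart) : gap_insert nc0 [:: x] = x.
Proof.
apply: ncpart_eq; first by rewrite /npoints /= /gap_insert_npoints big_ord1.
apply/fsetP => V; apply/gap_insert_blocksP/idP.
  move=> [[W]|[i [W [ile WP ->]]]]; first by rewrite inE.
  have i0 : i = 0 by move: ile; rewrite /npoints /=; lia.
  by subst i; rewrite imfset_id_in // => t _; rewrite offset0.
move=> VP; right; exists 0, V; split=> //.
by rewrite imfset_id_in // => t _; rewrite offset0.
Qed.

Lemma gap_insert_nseq (x : ncpart) n : gap_insert x (nseq n nc0) = x.
Proof.
have nthE i : nth nc0 (nseq n nc0) i = nc0 by rewrite nth_nseq if_same.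
have offE i : offset (nseq n nc0) i = i.
  by rewrite /offset big1 ?addn0 // => j _; rewrite nthE.
apply: ncpart_eq.
  by rewrite /npoints /= /gap_insert_npoints big1 ?addn0 // => j _; rewrite nthE.
apply/fsetP => V; apply/gap_insert_blocksP/idP.
  move=> [[W WP ->]|[i [W []]]]; last by rewrite nthE inE.
  by rewrite imfset_id_in.
by move=> VP; left; exists V; rewrite ?imfset_id_in.
Qed.

(** The effect of [nc_nabla] on basis words, isolated so that associativity and units can be proved
    without vectors. *)
Definition gap_inserts (b c : seq ncpart) : seq ncpart :=
  [seq gap_insert pq.1 pq.2
     | pq <- zip b (reshape [seq arity (y : NC) | y <- b] c)].

Lemma size_gap_inserts b c : size (gap_inserts b c) = size b.
Proof. by rewrite size_map size_zip size_reshape size_map minnn. Qed.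

Lemma nth_gap_inserts b c i : i < size b ->
  nth nc0 (gap_inserts b c) i
  = gap_insert (nth nc0 b i)
      (take (npoints (nth nc0 b i)).+1 (drop (offset b i) c)).
Proof.
move=> ib; rewrite (nth_map (nc0, [::])) ?size_zip ?size_reshape ?size_map ?minnn //.
rewrite nth_zip ?size_reshape ?size_map //= nth_reshape (nth_map nc0) //.
by rewrite offset_sumn // ltnW.
Qed.

(** * Associativity of gap insertion *)

Section Associativity.
Variables (b c : seq ncpart).

Local Notation part i := (take (npoints (nth nc0 b i)).+1 (drop (offset b i) c)).

Lemma nth_part i t : t <= npoints (nth nc0 b i) ->
  nth nc0 (part i) t = nth nc0 c (offset b i + t).
Proof. by move=> tle; rewrite nth_take // nth_drop. Qed.

Lemma offset_part i t : t <= (npoints (nth nc0 b i)).+1 ->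
  offset c (offset b i + t) = offset c (offset b i) + offset (part i) t.
Proof.
elim: t => [|t IH] tle; first by rewrite addn0 offset0 addn0.
by rewrite addnS !offsetS IH ?(ltnW tle) // nth_part //; lia.
Qed.

(** The letters of c fall into consecutive groups [part i], one per letter of b, and the i-th group
    accounts for exactly the points of the i-th composed letter. *)
Lemma offset_offset i : i <= size b ->
  offset c (offset b i) = offset (gap_inserts b c) i.
Proof.
elim: i => [|i IH] ib; first by rewrite !offset0.
rewrite offsetS -addnS offset_part // IH ?(ltnW ib) //.
by rewrite [RHS]offsetS nth_gap_inserts // -[RHS]addnS.
Qed.

Lemma offset_offsetD i t : i < size b -> t <= npoints (nth nc0 b i) ->
  offset c (offset b i + t) = offset (gap_inserts b c) i + offset (part i) t.
Proof. by move=> ib tle; rewrite offset_part ?leqW // offset_offset // ltnW. Qed.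

(** There are three kinds of blocks: those of x, of a letter of b and of a letter of c. A letter of
    c in gap [offset b i + t] of the left composition sits, on the right, in gap t of the i-th
    composed letter; [offset_offsetD] says that the positions agree. *)
Lemma gap_insertA (x : ncpart) : size b = (npoints x).+1 ->
  gap_insert (gap_insert x b) c = gap_insert x (gap_inserts b c).
Proof.
move=> sb; apply: ncpart_eq.
  apply: succn_inj; rewrite !npoints_gap_insertS.
  by rewrite offset_offset ?sb.
have bnd i W t : W \in blocks (nth nc0 b i) -> t \in W ->
    t <= npoints (nth nc0 b i).
  by move=> WP tW; have /andP[] := block_bounds WP tW.
have bndx W i : W \in blocks x -> i \in W -> i <= size b.
  by move=> WP tW; have /andP[_] := block_bounds WP tW; rewrite sb => /leqW.
apply/fsetP => V; apply/gap_insert_blocksP/gap_insert_blocksP.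
  move=> [[_ /gap_insert_blocksP[[W WP ->]|[i [W [ile WP ->]]]] ->]|].
  - left; exists W => //; apply: imfset_comp_in => z zW.
    by rewrite offset_offset // (bndx W).
  - right; exists i, [fset offset (part i) t | t in W]; split=> //.
      rewrite nth_gap_inserts ?sb //.
      by apply/gap_insert_blocksP; left; exists W.
    rewrite (imfset_comp_in (h := fun t => offset (gap_inserts b c) i + offset (part i) t)).
      rewrite (imfset_comp_in (h := fun t => offset (gap_inserts b c) i + offset (part i) t)) //.
    by move=> t tW; rewrite offset_offsetD ?sb ?(bnd i W).
  - move=> [g [W [gle WP ->]]].
    have [i [t [ile tle eg]]] := gap_decomp gle; subst g.
    right; exists i, [fset offset (part i) t + s | s in W]; split=> //.
      rewrite nth_gap_inserts ?sb //; apply/gap_insert_blocksP; right.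
      by exists t, W; rewrite nth_part.
    rewrite [RHS](imfset_comp_in (h := fun s => offset c (offset b i + t) + s)) //.
    by move=> s _; rewrite offset_offsetD ?sb // addnA.
move=> [[W WP ->]|[i [V' [ile]]]].
  left; exists [fset offset b z | z in W].
    by apply/gap_insert_blocksP; left; exists W.
  rewrite (imfset_comp_in (h := offset (gap_inserts b c))) // => z zW.
  by rewrite offset_offset // (bndx W).
rewrite nth_gap_inserts ?sb // => /gap_insert_blocksP[[W WP ->]|[t [W [tle WP ->]]]] ->.
  left; exists [fset offset b i + t | t in W].
    by apply/gap_insert_blocksP; right; exists i, W.
  rewrite (imfset_comp_in (h := fun t => offset (gap_inserts b c) i + offset (part i) t)) //.
  rewrite (imfset_comp_in (h := fun t => offset (gap_inserts b c) i + offset (part i) t)) //.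
  by move=> t tW; rewrite offset_offsetD ?sb ?(bnd i W).
right; exists (offset b i + t), W; split.
- rewrite -ltnS npoints_gap_insertS.
  by apply: leq_ltn_trans (offset_lt b (_ : i < _)); rewrite ?leq_add2l.
- by rewrite -nth_part.
- rewrite (imfset_comp_in (h := fun s => offset c (offset b i + t) + s)) //.
  by move=> s _; rewrite offset_offsetD ?sb // addnA.
Qed.

End Associativity.

Lemma in_fset_sep A (P : pred nat) z : (z \in [fset y in A | P y]) = (z \in A) && P z.
Proof. by rewrite !inE. Qed.

Lemma mem_interval n y : (y \in Defs.interval n) = (0 < y <= n).
Proof. by rewrite !inE mem_iota add1n ltnS. Qed.

Lemma card_interval n : #|` Defs.interval n| = n.
Proof. by rewrite card_fseq undup_id ?iota_uniq ?size_iota. Qed.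

Lemma card_imfset_interval (f : nat -> nat) n :
  {in Defs.interval n &, injective f} -> #|` [fset f x | x in Defs.interval n]| = n.
Proof. by move=> fI; rewrite card_in_imfset // card_interval. Qed.

(** An increasing map f sends 1, ..., y onto the points of its image up to f y, so the rank of f y
    is y and renumbering undoes f. This handles both the lower part and each gap of a cut. *)
Lemma sub_ncpart_image pi lam (P : pred {fset nat}) (f : nat -> nat) :
  {in Defs.interval (npoints lam) &, {mono f : i j / i < j}} ->
  [fset V in blocks pi | P V]
    = [fset [fset f y | y in W : {fset nat}] | W in blocks lam] ->
  sub_ncpart pi P = lam.
Proof.
move=> fM E.
have fI : {in Defs.interval (npoints lam) &, injective f}.
  move=> i j iP jP eij; have := fM i j iP jP; have := fM j i jP iP.
  by rewrite eij ltnn; case: ltngtP.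
have ptE : points [fset V in blocks pi | P V] = [fset f y | y in Defs.interval (npoints lam)].
  rewrite E -(nc_cover (ncpartP lam)); apply/fsetP => z; apply/pointsP/imfsetP.
    move=> [_ /imfsetP[/= W WP ->] /imfsetP[/= y yW ->]].
    by exists y => //; apply/pointsP; exists W.
  move=> [/= y /pointsP[W WP yW] ->]; exists [fset f y | y in W].
    by apply/imfsetP; exists W.
  by apply/imfsetP; exists y.
apply: ncpart_eq; first by rewrite /npoints /= ptE card_imfset_interval.
rewrite /blocks /= /renumber ptE E.
rewrite imfset_compK // => W WP /=.
rewrite imfset_compK // => y yW /=.
have yb := block_bounds WP yW; rewrite /rank.
have fIy : {in Defs.interval y &, injective f}.
  move=> i j; rewrite !mem_interval => iy jy.
  by apply: fI; rewrite mem_interval; lia.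
rewrite -[RHS](card_imfset_interval fIy); congr #|` _|; apply/fsetP => z.
rewrite in_fset_sep; apply/andP/imfsetP => [[/imfsetP[/= w wP ->] le_wy]|[/= w wy ->]].
  exists w => //; move: wP; rewrite !mem_interval => wP.
  by rewrite leqNgt fM ?mem_interval // -leqNgt in le_wy; lia.
move: wy; rewrite mem_interval => wy; split.
  by apply/imfsetP; exists w; rewrite // mem_interval; lia.
by rewrite leqNgt fM ?mem_interval // -?leqNgt; lia.
Qed.

Lemma block_max_ge V x : x \in V -> x <= block_max V.
Proof. by move=> xV; rewrite /block_max; apply: (@leq_bigmax_seq _ (enum_fset V) xpredT id). Qed.

Lemma block_max_le V m : {in V, forall x, x <= m} -> block_max V <= m.
Proof.
move=> Vm; rewrite /block_max big_seq.
by elim/big_ind: _ => // x y; rewrite geq_max => -> ->.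
Qed.

Lemma bigmin_le (s : seq nat) m x : x \in s -> \big[minn/m]_(y <- s) y <= x.
Proof.
elim: s => // y s IH; rewrite big_cons geq_min inE => /predU1P[->|/IH->].
  by rewrite leqnn.
by rewrite orbT.
Qed.

Lemma block_min_le V x : x \in V -> block_min V <= x.
Proof.
by move=> xV; apply: bigmin_le.
Qed.

(** The minimum starts from the default [block_max V], which also has to be bounded below; a point
    of V provides this. *)
Lemma block_min_ge V m : V != fset0 -> {in V, forall x, m <= x} -> m <= block_min V.
Proof.
move=> /fset0Pn[x xV] Vm; rewrite /block_min big_seq.
elim/big_ind: _ => [|y z my mz|]; [|by rewrite leq_min my|exact: Vm].
exact: leq_trans (Vm x xV) (block_max_ge xV).
Qed.

(** * From an insertion to a cut *)

Section Insertion.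
Variables (lam : ncpart) (ups : seq ncpart).
Hypothesis size_ups : size ups = (npoints lam).+1.

(** The candidate inverse of taking cuts: the lowerset to be recovered from a pair of a partition
    and a word. *)
Definition inserted_low : {fset {fset nat}} :=
  [fset [fset offset ups y | y in W : {fset nat}] | W in blocks lam].

Local Notation pi := (gap_insert lam ups).

Lemma offset_mono : {mono offset ups : i j / i < j}.
Proof.
move=> i j; have := @offset_lt_lex ups i j 0 0 (leq0n _) (leq0n _).
by rewrite !addn0 ltnn andbF orbF.
Qed.

Lemma offset_leD i j t : t <= npoints (nth nc0 ups j) ->
  (offset ups i <= offset ups j + t) = (i <= j).
Proof.
by move=> tle; rewrite -[offset ups i]addn0 leqNgt offset_lt_lex // ltn0 andbF orbF -leqNgt.
Qed.

Lemma offset_ltD i j t : 0 < t <= npoints (nth nc0 ups j) ->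
  (offset ups i < offset ups j + t) = (i <= j).
Proof.
move=> /andP[t0 tle]; rewrite -[offset ups i]addn0 offset_lt_lex // t0 andbT.
by rewrite orbC -leq_eqVlt.
Qed.

Lemma points_inserted_low :
  points inserted_low = [fset offset ups y | y in Defs.interval (npoints lam)].
Proof.
rewrite -(nc_cover (ncpartP lam)); apply/fsetP => z; apply/pointsP/imfsetP.
  move=> [_ /imfsetP[/= W WP ->] /imfsetP[/= y yW ->]].
  by exists y => //; apply/pointsP; exists W.
move=> [/= y /pointsP[W WP yW] ->]; exists [fset offset ups y | y in W].
  by apply/imfsetP; exists W.
by apply/imfsetP; exists y.
Qed.

Lemma card_points_inserted_low : #|` points inserted_low| = npoints lam.
Proof.
rewrite points_inserted_low card_imfset_interval // => i j _ _ eij.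
by have := offset_mono i j; have := offset_mono j i; rewrite eij ltnn; case: ltngtP.
Qed.

Lemma inserted_low_sub : inserted_low `<=` blocks pi.
Proof.
apply/fsubsetP => _ /imfsetP[/= W WP ->].
by apply/gap_insert_blocksP; left; exists W.
Qed.

(** A point [offset ups i + t] of an inserted block has t > 0, so it is never the image of a point
    of [lam]. *)
Lemma up_notin_low i W : W \in blocks (nth nc0 ups i) ->
  [fset offset ups i + t | t in W] \notin inserted_low.
Proof.
move=> WP; apply/negP => /imfsetP[/= V VP E].
have /fset0Pn[t tW] := nc_nonempty (ncpartP _) WP.
have : offset ups i + t \in [fset offset ups i + t | t in W].
  by apply/imfsetP; exists t.
rewrite E => /imfsetP[/= y yV].
have /andP[t0 tle] := block_bounds WP tW.
by rewrite -[offset ups y]addn0 => /offset_inj[] // _ et; rewrite et in t0.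
Qed.

(** The points of [lam] that end up before [offset ups i + t] are exactly the images of 1, ...,
    i. *)
Lemma in_gap_up i j W : i <= npoints lam -> W \in blocks (nth nc0 ups i) ->
  in_gap inserted_low j [fset offset ups i + t | t in W] = (i == j).
Proof.
move=> ile WP.
have cnt t : t \in W -> #|` [fset y in points inserted_low | y < offset ups i + t]| = i.
  move=> tW.
  have oI : {in Defs.interval i &, injective (offset ups)}.
    move=> k l _ _ ekl.
    by have := offset_mono k l; have := offset_mono l k; rewrite ekl ltnn; case: ltngtP.
  rewrite -[RHS](card_imfset_interval oI); congr #|` _|; apply/fsetP => z.
  rewrite in_fset_sep points_inserted_low.
  apply/andP/imfsetP => [[/imfsetP[/= k kP ->]]|[/= k kP ->]].
    rewrite offset_ltD ?(block_bounds WP) // => ki; exists k => //.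
    by move: kP; rewrite !mem_interval ki andbT => /andP[].
  move: kP; rewrite mem_interval => /andP[k0 ki].
  rewrite offset_ltD ?(block_bounds WP) // ki; split=> //.
  by apply/imfsetP; exists k; rewrite // mem_interval k0 (leq_trans ki).
have /fset0Pn[t0 t0W] := nc_nonempty (ncpartP _) WP.
apply/allP/idP => [/(_ (offset ups i + t0))|/eqP<- _ /imfsetP[/= t tW ->]].
  by rewrite cnt //; apply; apply/imfsetP; exists t0.
by rewrite cnt.
Qed.

(** An inserted block lies strictly between the images of two consecutive points of [lam], so no
    block of [lam] can be nested in it. *)
Lemma lowerset_inserted : inserted_low \in lowersets pi.
Proof.
rewrite mem_filter fpowersetE inserted_low_sub andbT.
apply/allP => _ /imfsetP[/= V VP ->]; apply/allP => U UP.
apply/implyP => /andP[_ /allP bds].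
case/gap_insert_blocksP: UP => [[W WP eU]|[i [W [ile WP eU]]]]; subst U.
  by apply/imfsetP; exists W.
have /fset0Pn[y yV] := nc_nonempty (ncpartP _) VP.
have /bds /andP[le_min le_max] : offset ups y \in [fset offset ups y | y in V].
  by apply/imfsetP; exists y.
have lo : offset ups i < offset ups y.
  apply: leq_trans le_min; apply: block_min_ge.
    have /fset0Pn[t tW] := nc_nonempty (ncpartP _) WP.
    by apply/fset0Pn; exists (offset ups i + t); apply/imfsetP; exists t.
  move=> _ /imfsetP[/= t tW ->]; have /andP[t0 _] := block_bounds WP tW.
  by rewrite -[X in X < _]addn0 ltn_add2l.
have hi : offset ups y <= offset ups i + npoints (nth nc0 ups i).
  apply: leq_trans le_max _; apply: block_max_le => _ /imfsetP[/= t tW ->].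
  by have /andP[_ tle] := block_bounds WP tW; rewrite leq_add2l.
by move: lo hi; rewrite offset_mono offset_leD // ltnNge => /negbTE->.
Qed.

Lemma cut_low_inserted : cut_low pi inserted_low = lam.
Proof.
apply: (sub_ncpart_image (f := offset ups)) => [i j _ _|]; first exact: offset_mono.
apply/fsetP => V; rewrite inE /=; apply: andb_idl => VL.
exact: (fsubsetP inserted_low_sub).
Qed.

Lemma cut_up_inserted : cut_up pi inserted_low = ups.
Proof.
apply: (@eq_from_nth _ nc0); rewrite size_map size_iota card_points_inserted_low //.
move=> i; rewrite ltnS => ile.
rewrite /cut_up (nth_map 0) ?size_iota ?card_points_inserted_low // nth_iota ?card_points_inserted_low //.
apply: (sub_ncpart_image (f := fun t => offset ups i + t)) => [j k _ _|].
  by rewrite ltn_add2l.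
apply/fsetP => V; rewrite inE /=; apply/andP/imfsetP.
  move=> [/gap_insert_blocksP[[W WP ->]|[j [W [jle WP ->]]]] /andP[nVL]].
    by case/negP: nVL; apply/imfsetP; exists W.
  by rewrite in_gap_up // => /eqP eij; subst j; exists W.
move=> [/= W WP ->]; split; last by rewrite up_notin_low // in_gap_up ?eqxx.
by apply/gap_insert_blocksP; right; exists i, W.
Qed.

End Insertion.

(** * From a cut to an insertion, by counting points *)

Lemma rankS A x : rank A x.+1 = rank A x + (x.+1 \in A).
Proof.
rewrite /rank; have -> : [fset y in A | y <= x.+1]
    = [fset y in A | y <= x] `|` [fset y in A | y == x.+1].
  apply/fsetP => y; rewrite !inE leq_eqVlt ltnS; case: (y \in A) => //=.
  by rewrite orbC.
rewrite cardfsU (_ : _ `&` _ = fset0) ?cardfs0 ?subn0; last first.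
  apply/fsetP => y; rewrite !inE; apply/negP.
  by move=> /andP[/andP[_ yx] /andP[_ /eqP ey]]; rewrite ey ltnn in yx.
congr (_ + _); case: (boolP (x.+1 \in A)) => xA.
  rewrite (_ : [fset y in A | _] = [fset x.+1]) ?cardfs1 //.
  apply/fsetP => y; rewrite !inE; apply/andP/eqP => [[_ /eqP] //|->].
  by split.
rewrite (_ : [fset y in A | _] = fset0) ?cardfs0 //.
apply/fsetP => y; rewrite !inE; apply/andP => -[yA /eqP ey].
by rewrite -ey yA in xA.
Qed.

Lemma rank_leq A x y : x <= y -> rank A x <= rank A y.
Proof.
move=> xy; apply: fsubset_leq_card; apply/fsubsetP => z; rewrite !inE.
by move=> /andP[-> zx]; exact: leq_trans zx xy.
Qed.

Lemma rank_all A x : {in A, forall y, y <= x} -> rank A x = #|` A|.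
Proof.
move=> Ax; congr #|` _|; apply/fsetP => y; rewrite !inE.
by apply: andb_idr => /Ax.
Qed.

Lemma rank_none A x : {in A, forall y, x < y} -> rank A x = 0.
Proof.
move=> Ax; apply/eqP; rewrite cardfs_eq0; apply/eqP/fsetP => y; rewrite !inE.
by apply/andP => -[/Ax]; rewrite ltnNge => /negbTE->.
Qed.

Lemma count_ltE A x : 0 < x -> #|` [fset y in A | y < x]| = rank A x.-1.
Proof. by case: x. Qed.

Section Cut.
Variables (pi : ncpart) (L : {fset {fset nat}}).
Hypothesis L_low : L \in lowersets pi.

Local Notation A := (points L).
Local Notation gap i := [fset W in blocks pi | (W \notin L) && in_gap L i W].
Local Notation G i := (points (gap i)).

Lemma lowerset_sub V : V \in L -> V \in blocks pi.
Proof. by move: L_low; rewrite mem_filter fpowersetE => /andP[_ /fsubsetP]; exact. Qed.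

Lemma lowerset_up V W : V \in L -> W \in blocks pi -> nested V W -> W \in L.
Proof.
move: L_low; rewrite mem_filter => /andP[/allP low _] VL WP.
by have /allP/(_ W WP)/implyP := low V VL.
Qed.

Lemma low_blocks : [fset V in blocks pi | V \in L] = L.
Proof.
apply/fsetP => V; rewrite !inE; apply: andb_idl; exact: lowerset_sub.
Qed.

Lemma block_uniq V W x : V \in blocks pi -> W \in blocks pi ->
  x \in V -> x \in W -> V = W.
Proof.
move=> VP WP xV xW; apply/eqP/negP => /negP nVW.
by have /fdisjointP /(_ x xV) := nc_disjoint (ncpartP pi) VP WP nVW; rewrite xW.
Qed.

(* A point of L strictly between two points of V would, by non-crossing, lie in
   a block nested in V, which would put V in L. *)
Lemma block_in_gap V x y : V \in blocks pi -> V \notin L ->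
  x \in V -> y \in V -> x < y -> rank A x.-1 = rank A y.-1.
Proof.
move=> VP VL xV yV xy; have /andP[x0 _] := block_bounds VP xV.
have y0 : 0 < y by lia.
rewrite -!count_ltE //; congr #|` _|; apply/fsetP => z; rewrite !inE.
apply: andb_id2l => /pointsP[W WL zW]; have WP := lowerset_sub WL.
have nWV : W != V by apply: contraNneq VL => <-.
apply/idP/idP => [zx|zy]; first exact: ltn_trans zx xy.
rewrite ltnNge leq_eqVlt; apply/negP => /predU1P[exz|xz].
  by subst z; rewrite (block_uniq WP VP zW xV) eqxx in nWV.
case/negP: VL; apply: (lowerset_up WL VP); rewrite /nested nWV /=.
have nx := @nc_noncrossing _ _ (ncpartP pi).
apply/allP => w wW; apply/andP; split.
  case: (leqP x w) => [xw|wx]; first exact: leq_trans (block_min_le xV) xw.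
  by case: (nx W V w x z y).
case: (leqP w y) => [wy|yw]; first exact: leq_trans wy (block_max_ge yV).
by case: (nx V W x z y w) => //; rewrite eq_sym.
Qed.

(** By [block_in_gap] a single point decides the gap of its whole block, so from here on gaps are
    described by counting alone. The predecessor appears because [in_gap] counts strictly smaller
    points whereas [rank] includes x. *)
Lemma gapP i x :
  reflect [/\ 0 < x <= npoints pi, x \notin A & rank A x.-1 = i] (x \in G i).
Proof.
apply: (iffP (pointsP _ _)) => [[V]|[xb xA ri]].
  rewrite !inE => /and3P[VP VL /allP Vi] xV; have xb := block_bounds VP xV.
  split=> //; last first.
    by have /eqP := Vi x xV; rewrite count_ltE //; case/andP: xb.
  apply/negP => /pointsP[W WL xW].
  by rewrite (block_uniq VP (lowerset_sub WL) xV xW) WL in VL.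
have [V VP xV] := block_of xb; exists V => //.
have VL : V \notin L by apply/negP => VL; case/negP: xA; apply/pointsP; exists V.
rewrite !inE VP VL; apply/allP => y yV; have /andP[y0 _] := block_bounds VP yV.
rewrite count_ltE // -ri; case: (ltngtP x y) => [xy|yx|-> //].
  by rewrite (block_in_gap VP VL xV yV xy).
by rewrite (block_in_gap VP VL yV xV yx).
Qed.

Lemma low_bounds x : x \in A -> 0 < x <= npoints pi.
Proof. by move=> /pointsP[V /lowerset_sub VP]; exact: block_bounds VP. Qed.

Lemma rank_low_le x : rank A x <= #|` A|.
Proof. by apply: fsubset_leq_card; apply/fsubsetP => y; rewrite !inE => /andP[]. Qed.

Lemma rank_gap_low x : x \in A -> rank (G (rank A x)) x = 0.
Proof.
move=> xA; have /andP[x0 _] := low_bounds xA.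
apply: rank_none => y /gapP[yb yA ry].
rewrite ltnNge leq_eqVlt; apply/negP => /predU1P[eyx|yx].
  by rewrite -eyx (negbTE yA) in xA *.
have : rank A x = (rank A x.-1).+1.
  by rewrite -{1}(prednK x0) rankS prednK // xA addn1.
by have := @rank_leq A y.-1 x.-1 ltac:(lia); rewrite ry; lia.
Qed.

(** The numbers 1, ..., x are sorted into points of L, points of the closed gaps, and points of the
    current gap, which is gap [rank A x]. The next number either belongs to L and closes the current
    gap, or enlarges it. *)
Lemma rank_decomp x : x <= npoints pi ->
  x = rank A x + \sum_(j < rank A x) #|` G j| + rank (G (rank A x)) x.
Proof.
elim: x => [_|x IH xn].
  rewrite !(rank_none (A := A)) ?big_ord0; last first.
    by move=> y /low_bounds /andP[].
  by rewrite rank_none // => y /gapP[/andP[]].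
case: (boolP (x.+1 \in A)) => xA.
  rewrite rank_gap_low // addn0.
  have := IH (ltnW xn); rewrite rankS xA addn1 big_ord_recr /=.
  (* All points of the gap closed by [x.+1] are at most x: a later point would have [x.+1] among the
     points of L before it, hence a larger gap number. *)
  rewrite (rank_all (A := G _)) => [|y /gapP[yb yA ry]]; first by move=> e; rewrite addSn addnA -e.
  rewrite leqNgt; apply/negP; rewrite leq_eqVlt => /predU1P[exy|xy].
    by rewrite -exy xA in yA.
  have := @rank_leq A x.+1 y.-1 ltac:(lia); rewrite rankS xA ry; lia.
have := IH (ltnW xn); rewrite !rankS (negbTE xA) addn0.
suff -> : x.+1 \in G (rank A x) by move=> e; rewrite addn1 addnS -e.
by apply/gapP; split.
Qed.

Lemma npoints_cut_low : npoints (cut_low pi L) = #|` A|.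
Proof. by rewrite /npoints /= low_blocks. Qed.

Lemma size_cut_up : size (cut_up pi L) = (npoints (cut_low pi L)).+1.
Proof. by rewrite npoints_cut_low size_map size_iota. Qed.

Lemma nth_cut_up i : i <= #|` A| ->
  nth nc0 (cut_up pi L) i = sub_ncpart pi (fun W => (W \notin L) && in_gap L i W).
Proof. by move=> ile; rewrite /cut_up (nth_map 0) ?size_iota // nth_iota. Qed.

Lemma npoints_cut_up i : i <= #|` A| -> npoints (nth nc0 (cut_up pi L) i) = #|` G i|.
Proof. by move=> ile; rewrite nth_cut_up. Qed.

Lemma offset_cut_up i : i <= #|` A|.+1 ->
  offset (cut_up pi L) i = i + \sum_(j < i) #|` G j|.
Proof.
move=> ile; congr (_ + _); apply: eq_bigr => j _; apply: npoints_cut_up.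
by rewrite -ltnS; apply: leq_trans (ltn_ord j) ile.
Qed.

(** In [rank_decomp] the term of the current gap vanishes, because that gap opens only after x. *)
Lemma offset_rank_low x : x \in A -> offset (cut_up pi L) (rank A x) = x.
Proof.
move=> xA; have /andP[_ xn] := low_bounds xA.
rewrite offset_cut_up ?leqW ?rank_low_le // [RHS](rank_decomp xn).
by rewrite rank_gap_low // addn0.
Qed.

Lemma offset_rank_gap i x : x \in G i ->
  i <= #|` A| /\ offset (cut_up pi L) i + rank (G i) x = x.
Proof.
move=> xG; have /gapP[/andP[x0 xn] xA ri] := xG.
have eri : rank A x = i by rewrite -ri -{1}(prednK x0) rankS prednK // (negbTE xA) addn0.
have ile : i <= #|` A| by rewrite -eri rank_low_le.
by rewrite offset_cut_up ?leqW // [RHS](rank_decomp xn) eri.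
Qed.

Lemma blocks_cut_low : blocks (cut_low pi L) = [fset [fset rank A x | x in V : {fset nat}] | V in L].
Proof. by rewrite /blocks /= low_blocks. Qed.

Lemma inserted_low_cut : inserted_low (cut_low pi L) (cut_up pi L) = L.
Proof.
rewrite /inserted_low blocks_cut_low imfset_compK //.
move=> V VL; rewrite imfset_compK // => x xV.
by apply: offset_rank_low; apply/pointsP; exists V.
Qed.

Lemma gap_insert_cut : gap_insert (cut_low pi L) (cut_up pi L) = pi.
Proof.
apply: ncpart_eq.
  apply: succn_inj; rewrite npoints_gap_insertS npoints_cut_low offsetS.
  rewrite npoints_cut_up // offset_cut_up //.
  have := rank_decomp (leqnn (npoints pi)).
  have -> : rank A (npoints pi) = #|` A|.
    by apply: rank_all => y /low_bounds /andP[].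
  by rewrite (rank_all (A := G _)) => [<-|y /gapP[/andP[]]].
have gapE i W : i <= #|` A| -> W \in gap i ->
    [fset offset (cut_up pi L) i + t
      | t in [fset rank (G i) x | x in W]] = W.
  move=> ile WG; rewrite imfset_compK // => x xW.
  by case: (@offset_rank_gap i x) => //; apply/pointsP; exists W.
apply/fsetP => V; apply/idP/idP.
  case/gap_insert_blocksP => [[W WP ->]|[i [W [ile WP ->]]]].
    apply: lowerset_sub; rewrite -{2}inserted_low_cut.
    by apply/imfsetP; exists W.
  move: ile WP; rewrite npoints_cut_low => ile; rewrite nth_cut_up // /blocks /=.
  by move=> /imfsetP[/= U UG ->]; rewrite gapE //; move: UG; rewrite !inE => /andP[].
move=> VP; apply/gap_insert_blocksP.
case: (boolP (V \in L)) => [VL|VL].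
  left; move: VL; rewrite -{1}inserted_low_cut => /imfsetP[/= W WP eV].
  by exists W.
(* Any point x of a block outside L gives the gap of that block. *)
have /fset0Pn[x xV] := nc_nonempty (ncpartP _) VP.
have xG : x \in G (rank A x.-1).
  apply/gapP; split=> //; first exact: block_bounds VP xV.
  apply/negP => /pointsP[W WL xW].
  by rewrite (block_uniq VP (lowerset_sub WL) xV xW) WL in VL.
have [ile _] := offset_rank_gap xG.
have VG : V \in gap (rank A x.-1).
  have /pointsP[W WG xW] := xG; rewrite (@block_uniq V W x) //.
  by move: WG; rewrite !inE => /andP[].
right; exists (rank A x.-1), [fset rank (G (rank A x.-1)) y | y in V]; split.
- by rewrite npoints_cut_low.
- by rewrite nth_cut_up // /blocks /=; apply/imfsetP; exists V.
- by rewrite gapE.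
Qed.

End Cut.

(** The first point of [lam] moves to [offset ups 1], which is 1 exactly when nothing is inserted
    before it. If [lam] has no point, the composition is the single letter of [ups], so this letter
    is non-empty. *)
Lemma one_in_inserted_low lam ups : size ups = (npoints lam).+1 ->
  gap_insert lam ups != nc0 ->
  (1 \in points (inserted_low lam ups)) = (nth nc0 ups 0 == nc0).
Proof.
move=> sz nz; rewrite points_inserted_low -npoints_eq0.
apply/imfsetP/eqP => [[/= [|i]]|e0]; first by rewrite mem_interval.
  by case: ups sz nz => // y b' _ _ _; rewrite offset_cons /=; lia.
exists 1; last by rewrite /offset big_ord1 e0.
rewrite mem_interval /= lt0n npoints_eq0.
apply: contra_eqN e0 => /eqP l0; rewrite npoints_eq0; subst lam.
case: ups sz nz => [|y []] // _.
by rewrite gap_insert_nc0.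
Qed.

End GapInsertion.

(** * Cuts of words *)

#[local] Arguments inp {_} _ : simpl never.
#[local] Arguments gap_inserts : simpl never.
Local Notation inw w := (@inp (words NC) w).

Section WordCuts.
Local Open Scope nat_scope.
Implicit Types (pi lam : ncpart) (a b w : seq ncpart).

Definition trivial_word w := all (fun pi => pi == nc0) w.

(** On a trivial word the value is its length, a convention under which the minimum formula
    [find_gap_inserts] holds without exceptions. *)
Definition first_nontrivial w := find (fun pi => pi != nc0) w.

Lemma inw_cons pi w : inw (pi :: w) = (npoints pi).+1 + inw w.
Proof. by []. Qed.

Lemma inw1 pi : inw [:: pi] = (npoints pi).+1.
Proof. by rewrite inw_cons addn0. Qed.

Lemma inw_cat a b : inw (a ++ b) = inw a + inw b.
Proof. by rewrite /inp /= map_cat sumn_cat. Qed.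

Lemma size_cons pi w : size (pi :: w) = (size w).+1.
Proof. by []. Qed.

Lemma size_le_inw w : size w <= inw w.
Proof. by elim: w => // pi w IH; rewrite inw_cons size_cons; lia. Qed.

Lemma inw_nseq n : inw (nseq n nc0) = n.
Proof. by elim: n => // n IH; rewrite /= -[in RHS]IH. Qed.

(** Each letter has one more input than it has points, so [inw w - size w] is the number of points
    of w. Hence trivial words are the basis of the diagonal part. *)
Lemma size_inw w : (size w == inw w) = trivial_word w.
Proof.
elim: w => // pi w IH; rewrite inw_cons size_cons [RHS]/= -IH -npoints_eq0.
by have := size_le_inw w; lia.
Qed.

Lemma trivial_wordP w : reflect (w = nseq (size w) nc0) (trivial_word w).
Proof. exact: all_pred1P. Qed.

Lemma trivial_nseq n : trivial_word (nseq n nc0).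
Proof. by rewrite /trivial_word all_nseq eqxx orbT. Qed.

Lemma gap_inserts_cons pi a b : gap_inserts (pi :: a) b
  = gap_insert pi (take (npoints pi).+1 b) :: gap_inserts a (drop (npoints pi).+1 b).
Proof. by []. Qed.

Lemma gap_inserts_cat a a' b b' : inw a = size b ->
  gap_inserts (a ++ a') (b ++ b') = gap_inserts a b ++ gap_inserts a' b'.
Proof.
elim: a b => [|pi a IH] b; first by move/esym/size0nil->.
rewrite inw_cons => sb; rewrite cat_cons !gap_inserts_cons cat_cons.
have le : (npoints pi).+1 <= size b by lia.
rewrite takel_cat // drop_cat; case: ltnP => [lt|ge].
  by rewrite IH // size_drop -sb; lia.
have e : size b = (npoints pi).+1 by lia.
have a0 : a = [::] by apply: size0nil; have := size_le_inw a; lia.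
by rewrite a0 e subnn drop0.
Qed.

Lemma npoints_gap_insert_inw pi b : size b = (npoints pi).+1 ->
  (npoints (gap_insert pi b)).+1 = inw b.
Proof.
by move=> sb; rewrite npoints_gap_insertS offset_sumn ?sb // take_oversize // size_map sb.
Qed.

Lemma inw_gap_inserts a b : inw a = size b -> inw (gap_inserts a b) = inw b.
Proof.
elim: a b => [|pi a IH] b; first by move/esym/size0nil->.
rewrite inw_cons => sb; rewrite gap_inserts_cons inw_cons IH ?size_drop -?sb; last by lia.
rewrite npoints_gap_insert_inw ?size_takel; try lia.
by rewrite -inw_cat cat_take_drop.
Qed.

Lemma gap_insertsA a b (c : seq ncpart) : inw a = size b -> inw b = size c ->
  gap_inserts (gap_inserts a b) c = gap_inserts a (gap_inserts b c).
Proof.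
elim: a b c => [|pi a IH] b c; first by move/esym/size0nil->.
rewrite inw_cons => sb sc; pose n := (npoints pi).+1.
have sb1 : size (take n b) = n by rewrite size_takel // /n; lia.
have sb2 : inw a = size (drop n b) by rewrite size_drop -sb /n; lia.
have inwb : inw b = inw (take n b) + inw (drop n b) by rewrite -inw_cat cat_take_drop.
(* The first letter of a takes n letters of b, and these in turn take m letters of c. *)
pose m := inw (take n b).
have sc1 : inw (take n b) = size (take m c) by rewrite size_takel -?sc ?inwb ?leq_addr.
have sc2 : inw (drop n b) = size (drop m c).
  by rewrite size_drop -sc inwb /m addKn.
rewrite gap_inserts_cons -/n [LHS]gap_inserts_cons npoints_gap_insert_inw // -/m.
rewrite gap_inserts_cons -[b in RHS](cat_take_drop n) -[c in RHS](cat_take_drop m).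
rewrite gap_inserts_cat // take_size_cat ?size_gap_inserts //.
rewrite drop_size_cat ?size_gap_inserts // -IH // -gap_insertA //.
Qed.

Lemma gap_inserts1l n b : size b = n -> gap_inserts (nseq n nc0) b = b.
Proof.
elim: n b => [|n IH] [|pi b] //= [sb].
by rewrite gap_inserts_cons /= take0 drop0 gap_insert_nc0 IH.
Qed.

Lemma gap_inserts1r a n : inw a = n -> gap_inserts a (nseq n nc0) = a.
Proof.
elim: a n => // pi a IH n; rewrite inw_cons => <-.
by rewrite gap_inserts_cons take_nseq ?leq_addr // drop_nseq addKn gap_insert_nseq IH.
Qed.

(** In [size a <= inw a = size b <= inw b] the two ends agree exactly when both inequalities are
    equalities. *)
Lemma trivial_gap_inserts a b : inw a = size b ->
  trivial_word (gap_inserts a b) = trivial_word a && trivial_word b.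
Proof.
move=> sb; rewrite -!size_inw inw_gap_inserts // size_gap_inserts.
have := size_le_inw a; have := size_le_inw b; lia.
Qed.

Lemma first_nontrivial_cons pi w : first_nontrivial (pi :: w)
  = if pi == nc0 then (first_nontrivial w).+1 else 0.
Proof. by rewrite /first_nontrivial /=; case: eqP. Qed.

(** As long as a starts with empty partitions, each of them passes one letter of b through
    unchanged. The common empty prefix ends at the first non-empty letter of a or of b. *)
Lemma find_gap_inserts a b : inw a = size b ->
  first_nontrivial (gap_inserts a b)
  = minn (first_nontrivial a) (first_nontrivial b).
Proof.
elim: a b => [|pi a IH] b; first by move/esym/size0nil->.
case: (eqVneq pi nc0) => [->|nz]; last first.
  move=> _; rewrite gap_inserts_cons !first_nontrivial_cons (negbTE nz) min0n.
  rewrite ifF //; apply: contraNF nz => /eqP e0.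
  have : npoints (gap_insert pi (take (npoints pi).+1 b)) == 0 by rewrite e0.
  by rewrite -npoints_eq0 addn_eq0 => /andP[].
case: b => [|p b] //; rewrite inw_cons size_cons add1n => -[sb].
rewrite gap_inserts_cons !first_nontrivial_cons /= take0 drop0 gap_insert_nc0.
by case: (p == nc0); rewrite ?minn0 // minnSS -IH.
Qed.

Lemma first_nontrivial_trivial w : trivial_word w -> first_nontrivial w = size w.
Proof.
move/allP => tw; apply: hasNfind; apply/hasPn => x /tw /= /eqP->.
by rewrite negbK.
Qed.

Lemma first_nontrivial_lt w : (first_nontrivial w < size w) = ~~ trivial_word w.
Proof. by rewrite -has_find /trivial_word -has_predC; apply: eq_has. Qed.

Lemma first_nontrivial_cat a b : first_nontrivial (a ++ b)
  = if trivial_word a then size a + first_nontrivial b else first_nontrivial a.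
Proof. by rewrite /first_nontrivial find_cat has_find first_nontrivial_lt; case: trivial_word. Qed.

Definition letter_cuts pi : seq (seq ncpart * seq ncpart) :=
  [seq ([:: cut_low pi L], cut_up pi L) | L <- lowersets pi].

Definition cat2 (c d : seq ncpart * seq ncpart) := (c.1 ++ d.1, c.2 ++ d.2).

(** Follows the recursion of [words_ext], so that the coproduct of a word becomes a sum over this
    list. *)
Definition cuts w : seq (seq ncpart * seq ncpart) :=
  foldr (fun pi s => [seq cat2 c d | c <- letter_cuts pi, d <- s])
    [:: ([::], [::])] w.

Lemma letter_cutsP pi a b :
  reflect (inw a = size b /\ gap_inserts a b = [:: pi]) ((a, b) \in letter_cuts pi).
Proof.
apply: (iffP mapP) => [[L Ll [-> ->]]|[sb e]].
  rewrite inw1 size_cut_up //; split=> //.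
  rewrite gap_inserts_cons take_oversize ?size_cut_up // gap_insert_cut //.
move: sb (congr1 size e); rewrite size_gap_inserts.
case: a e => [|lam []] // [<-]; rewrite inw1 => sb _.
rewrite take_oversize -?sb //; exists (inserted_low lam b).
  by apply: lowerset_inserted.
by rewrite cut_low_inserted ?cut_up_inserted.
Qed.

(** L is recovered from its cut by [inserted_low_cut]; so a sum over lowersets counts every
    composable pair once. *)
Lemma letter_cuts_uniq pi : uniq (letter_cuts pi).
Proof.
rewrite map_inj_in_uniq ?filter_uniq ?fset_uniq // => L L' Ll Ll' e.
have el : cut_low pi L = cut_low pi L' := congr1 (fun c => head nc0 c.1) e.
have eu : cut_up pi L = cut_up pi L' := congr1 snd e.
by rewrite -(inserted_low_cut Ll) -(inserted_low_cut Ll') el eu.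
Qed.

Lemma cutsP w a b :
  reflect (inw a = size b /\ gap_inserts a b = w) ((a, b) \in cuts w).
Proof.
apply: (iffP idP); elim: w a b => [|pi w IH] a b /=.
- by rewrite inE => /eqP[-> ->].
- move/allpairsP => [[[a1 b1] [a2 b2]] /= [/letter_cutsP[s1 e1] /IH[s2 e2] [-> ->]]].
  by rewrite inw_cat size_cat s1 s2 gap_inserts_cat // e1 e2.
- by case: a => [|lam a] [sb e] //; rewrite (size0nil (esym sb)).
- case: a => [[_ /(congr1 size)]|lam a]; first by rewrite size_gap_inserts.
  rewrite inw_cons gap_inserts_cons => -[sb [e1 e2]].
  apply/allpairsP; pose n := (npoints lam).+1.
  exists (([:: lam], take n b), (a, drop n b)); split=> /=.
  + apply/letter_cutsP; rewrite inw1 size_takel -?sb ?leq_addr //.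
    by split=> //; rewrite gap_inserts_cons take_oversize ?size_take_min ?geq_minl // e1.
  + by apply: IH; split=> //; rewrite size_drop -sb addKn.
  + by rewrite /cat2 /= cat_take_drop.
Qed.

(** A concatenation determines its two cuts: the lower part of a letter cut has one letter, and the
    inputs of the lower part give the length of the upper part. *)
Lemma cuts_uniq w : uniq (cuts w).
Proof.
elim: w => //= pi w IH; apply: allpairs_uniq; rewrite ?letter_cuts_uniq //.
move=> x y /allpairsP[[[a b] [c d]] /= [/letter_cutsP[s1 e1] _ ->]] {x}.
move=> /allpairsP[[[a' b'] [c' d']] /= [/letter_cutsP[s2 e2] _ ->]] {y} /= [ea eb].
have sa : size a = size a' by rewrite -(size_gap_inserts a b) -(size_gap_inserts a' b') e1 e2.
move: ea => /eqP; rewrite eqseq_cat // => /andP[/eqP ea /eqP->]; subst a'.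
move: eb => /eqP; rewrite eqseq_cat -?s1 -?s2 // => /andP[/eqP-> /eqP->] //.
Qed.

End WordCuts.

(** * Sums over the cuts of a word *)

Section CutSums.
Variable V : nmodType.
Implicit Types (F : seq ncpart * seq ncpart -> V) (a b w : seq ncpart) (pi : ncpart).

Lemma big_cuts_cons pi w F :
  \sum_(c <- cuts (pi :: w)) F c
  = \sum_(c <- letter_cuts pi) \sum_(d <- cuts w) F (cat2 c d).
Proof. by rewrite [LHS]big_allpairs_dep. Qed.

Lemma big_cuts_nil F : \sum_(c <- cuts [::]) F c = F ([::], [::]).
Proof. exact: big_seq1. Qed.

Lemma big_cuts_cat a b F :
  \sum_(c <- cuts (a ++ b)) F c
  = \sum_(c <- cuts a) \sum_(d <- cuts b) F (cat2 c d).
Proof.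
elim: a F => [|pi a IH] F.
  by rewrite big_cuts_nil; apply: eq_bigr => -[].
rewrite cat_cons !big_cuts_cons; apply: eq_bigr => c _.
rewrite IH; apply: eq_bigr => d _; apply: eq_bigr => e _.
by rewrite /cat2 /= !catA.
Qed.

Lemma big_cuts1 pi F : \sum_(c <- cuts [:: pi]) F c = \sum_(c <- letter_cuts pi) F c.
Proof.
rewrite big_cuts_cons; apply: eq_bigr => -[a b] _.
by rewrite big_cuts_nil /cat2 /= !cats0.
Qed.

Lemma big_uniq_pred1 (I : eqType) (r : seq I) (i : I) (P : pred I) (F : I -> V) :
  uniq r -> i \in r -> (forall j, j \in r -> P j = (j == i)) ->
  \sum_(j <- r | P j) F j = F i.
Proof.
move=> ur ir Pi; rewrite big_seq_cond (eq_bigl (pred1 i)) => [|j /=].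
  by rewrite -big_filter filter_pred1_uniq // big_seq1.
case: (boolP (j \in r)) => [/Pi //|jr]; apply/esym; apply: contraNF jr.
by move/eqP->.
Qed.

(** Composition with empty partitions below returns the upper word, so exactly one cut qualifies. It
    gives the term [1_n ⊠ w] and the left counit law. *)
Lemma big_cuts_trivial_low w F :
  \sum_(c <- cuts w | trivial_word c.1) F c = F (nseq (size w) nc0, w).
Proof.
apply: (big_uniq_pred1 F (cuts_uniq w)).
  by apply/cutsP; rewrite inw_nseq gap_inserts1l.
move=> [a b] /cutsP[sb e] /=; apply/idP/eqP => [/trivial_wordP ea|[-> _]]; last first.
  exact: trivial_nseq.
have sw : size w = size a by rewrite -e size_gap_inserts.
have eb : size b = size a by rewrite -sb {1}ea inw_nseq.
have ew : w = b by rewrite -e ea gap_inserts1l.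
by rewrite sw -ea ew.
Qed.

Lemma big_cuts_trivial_up w F :
  \sum_(c <- cuts w | trivial_word c.2) F c = F (w, nseq (inw w) nc0).
Proof.
apply: (big_uniq_pred1 F (cuts_uniq w)).
  by apply/cutsP; rewrite size_nseq gap_inserts1r.
move=> [a b] /cutsP[sb e] /=; apply/idP/eqP => [/trivial_wordP eb|[_ ->]]; last first.
  exact: trivial_nseq.
by rewrite -e eb gap_inserts1r // -sb.
Qed.

Lemma cuts_nseq n F : \sum_(c <- cuts (nseq n nc0)) F c = F (nseq n nc0, nseq n nc0).
Proof.
rewrite big_seq_cond (eq_bigl (fun c => (c \in cuts (nseq n nc0)) && trivial_word c.1)).
  by rewrite -big_seq_cond big_cuts_trivial_low size_nseq.
move=> [a b] /=; apply: andb_id2l => /cutsP[sb e].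
by have := trivial_gap_inserts sb; rewrite e trivial_nseq; case: trivial_word.
Qed.

(* Both sides run once over the triples (x, y, z) whose iterated insertion is w. *)
Lemma big_cuts_assoc w (F : seq ncpart -> seq ncpart -> seq ncpart -> V) :
  \sum_(c <- cuts w) \sum_(d <- cuts c.1) F d.1 d.2 c.2
  = \sum_(c <- cuts w) \sum_(d <- cuts c.2) F c.1 d.1 d.2.
Proof.
pose T1 := [seq (d.1, d.2, c.2) | c <- cuts w, d <- cuts c.1].
pose T2 := [seq (c.1, d.1, d.2) | c <- cuts w, d <- cuts c.2].
transitivity (\sum_(t <- T1) F t.1.1 t.1.2 t.2); first by rewrite big_allpairs_dep.
transitivity (\sum_(t <- T2) F t.1.1 t.1.2 t.2); last by rewrite big_allpairs_dep.
apply: perm_big; apply: uniq_perm.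
- apply: allpairs_uniq_dep => [|c _|]; try exact: cuts_uniq.
  move=> t t' /allpairsPdep[[l u] [[x y] /= [_ /cutsP[/= _ <-] ->]]].
  move=> /allpairsPdep[[l' u'] [[x' y'] /= [_ /cutsP[/= _ <-] ->]]] /=.
  by move=> [-> -> ->].
- apply: allpairs_uniq_dep => [|c _|]; try exact: cuts_uniq.
  move=> t t' /allpairsPdep[[l u] [[x y] /= [_ /cutsP[/= _ <-] ->]]].
  move=> /allpairsPdep[[l' u'] [[x' y'] /= [_ /cutsP[/= _ <-] ->]]] /=.
  by move=> [-> -> ->].
move=> [[x y] z]; apply/allpairsPdep/allpairsPdep.
  move=> [[l u] [[x' y'] /= [/cutsP[s1 e1] /cutsP[s2 e2] [-> -> ->]]]].
  subst l; rewrite inw_gap_inserts // in s1.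
  exists (x', gap_inserts y' u), (y', u); split=> //; apply/cutsP => //.
  by rewrite size_gap_inserts -gap_insertsA.
move=> [[l u] [[y' z'] /= [/cutsP[s1 e1] /cutsP[s2 e2] [-> -> ->]]]].
subst u; rewrite size_gap_inserts in s1.
exists (gap_inserts l y', z'), (l, y'); split=> //; apply/cutsP => //.
by rewrite inw_gap_inserts // gap_insertsA.
Qed.

End CutSums.

(** * Coproducts as sums over selected cuts *)

Section Operations.
Variable K : fieldType.
Local Notation TNC := (words NC).
Local Notation TNCalg := (words_alg K NC).
Local Notation word w := (<< (w : TNC) >> : vect K TNC).
Local Notation vmul := (hmul (vprod_alg TNCalg TNCalg)).
Implicit Types (a b w : seq ncpart).

Lemma hmul_words_linear (P : coll) : linear (hmul (words_alg K P)).
Proof. exact: lin_ext_is_linear. Qed.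

Lemma hmul_wordsU (P : coll) (a b : seq P) :
  hmul (words_alg K P) (<< (a : words P) >> ⊗ << (b : words P) >>)
  = << (a ++ b : words P) >>.
Proof. by rewrite htenU /= lin_extU. Qed.

Lemma hmul_vprod_linear (A B : halg K) : linear (hmul (vprod_alg A B)).
Proof. by apply: linear_comp; apply: lin_ext_is_linear. Qed.

Lemma vmulU a b a' b' : inw a = size b -> inw a' = size b' ->
  vmul ((word a ⊠ word b) ⊗ (word a' ⊠ word b'))
  = word (a ++ a') ⊠ word (b ++ b').
Proof.
move=> sb sb'; rewrite /hmul /= exchangeU // !htenU vmapU /= ?lin_extU //.
by rewrite /inp /= -/(inw a) -/(inw a') sb sb'.
Qed.

(** A common form for the coproduct, the reduced coproduct, the two half-coproducts and, on
    non-trivial words, their versions with a plus. They differ only in the selection P, which may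
    depend on the word being cut. *)
Definition cut_coprod (P : seq ncpart -> pred (seq ncpart * seq ncpart)) :
    vect K TNC -> vect K (TNC ⊠ TNC) :=
  lin_ext (fun w : TNC => \sum_(c <- cuts w | P w c) word c.1 ⊠ word c.2).

Implicit Types P Q : seq ncpart -> pred (seq ncpart * seq ncpart).

Lemma cut_coprod_linear P : linear (cut_coprod P).
Proof. exact: lin_ext_is_linear. Qed.

Lemma cut_coprodU P w :
  cut_coprod P (word w) = \sum_(c <- cuts w | P w c) word c.1 ⊠ word c.2.
Proof. by rewrite /cut_coprod lin_extU. Qed.

Lemma cut_coprod_bimorphism P : bimorphism (cut_coprod P).
Proof.
apply: bimorphism_lin_ext => w; apply: homog_sum_seq => -[a b] /cutsP[/= sb e] _.
by apply: vtenU_homog; rewrite /= -e ?inw_gap_inserts // /outp /= size_gap_inserts.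
Qed.

Lemma vmap_cut_coprod (Q R : bicoll) P (f : vect K TNC -> vect K Q)
    (g : vect K TNC -> vect K R) w :
  vmap f g (cut_coprod P (word w))
  = \sum_(c <- cuts w | P w c) f (word c.1) ⊠ g (word c.2).
Proof.
rewrite cut_coprodU /vmap linear_sum big_seq_cond [RHS]big_seq_cond.
apply: eq_bigr => -[a b] /andP[/cutsP[sb _] _]; exact: vmapU.
Qed.

(** The four selections may differ, so that this covers coassociativity as well as the three
    unshuffle relations. *)
Lemma cut_coprod_assoc P1 P2 Q1 Q2 :
  (forall x y z, inw x = size y -> inw y = size z ->
     let w := gap_inserts x (gap_inserts y z) in
     P2 w (gap_inserts x y, z) && P1 (gap_inserts x y) (x, y)
     = Q2 w (x, gap_inserts y z) && Q1 (gap_inserts y z) (y, z)) ->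
  forall u, vassoc (vmap (cut_coprod P1) id (cut_coprod P2 u))
    = vmap id (cut_coprod Q1) (cut_coprod Q2 u).
Proof.
move=> PQ; apply: eq_linear => [||w].
- do 2![apply: (linear_comp (lin_ext_is_linear _))]; exact: cut_coprod_linear.
- by apply: (linear_comp (lin_ext_is_linear _)); exact: cut_coprod_linear.
rewrite !vmap_cut_coprod /vassoc linear_sum /=.
(* The value 0 off composable triples makes F total; on the remaining triples the hypothesis lets
   one F express both sides. *)
pose F x y z := if [&& inw x == size y, inw y == size z &
    P2 (gap_inserts x (gap_inserts y z)) (gap_inserts x y, z)
      && P1 (gap_inserts x y) (x, y)]
  then word x ⊠ (word y ⊠ word z) else 0.
transitivity (\sum_(c <- cuts w) \sum_(d <- cuts c.1) F d.1 d.2 c.2).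
  rewrite big_mkcond; apply: eq_big_seq => -[l u] /cutsP[s1 e1] /=.
  have -> : (if P2 w (l, u) then
       lin_ext (fun x : (TNC ⊠ TNC ⊠ TNC)%bic =>
         << (val (val x).1).1 >> ⊠ (<< (val (val x).1).2 >> ⊠ << (val x).2 >>))
         (cut_coprod P1 (word l) ⊠ word u) else 0)
      = \sum_(d <- cuts l) if P2 w (l, u) && P1 l d then
           word d.1 ⊠ (word d.2 ⊠ word u) else 0.
    case: ifP => _; last by rewrite big1.
    rewrite cut_coprodU vten_suml linear_sum -big_mkcond.
    by apply: eq_bigr => d _; exact: vassocU.
  apply: eq_big_seq => -[x y] /cutsP[s2 e2] /=.
  subst l; rewrite inw_gap_inserts // in s1.
  by rewrite /F s1 s2 !eqxx /= -gap_insertsA // e1.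
rewrite big_cuts_assoc [RHS]big_mkcond; apply: eq_big_seq => -[x u] /cutsP[s1 e1] /=.
have -> : (if Q2 w (x, u) then word x ⊠ cut_coprod Q1 (word u) else 0)
    = \sum_(d <- cuts u) if Q2 w (x, u) && Q1 u d then
           word x ⊠ (word d.1 ⊠ word d.2) else 0.
  case: ifP => _; last by rewrite big1.
  by rewrite cut_coprodU vten_sumr -big_mkcond.
apply: eq_big_seq => -[y z] /cutsP[s2 e2] /=.
by subst u; rewrite size_gap_inserts in s1; rewrite /F s1 s2 !eqxx /= PQ // e1.
Qed.

Lemma cut_coprod_mul P Q1 Q2 a b :
  (forall c d, c \in cuts a -> d \in cuts b ->
     P (a ++ b) (cat2 c d) = Q1 a c && Q2 b d) ->
  cut_coprod P (word (a ++ b))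
  = vmul (cut_coprod Q1 (word a) ⊗ cut_coprod Q2 (word b)).
Proof.
move=> PQ; rewrite !cut_coprodU hten_suml (linear_big (@hmul_vprod_linear _ _)).
rewrite big_mkcond big_cuts_cat [RHS]big_mkcond; apply: eq_big_seq => c cP.
have -> : (if Q1 a c then vmul ((word c.1 ⊠ word c.2) ⊗
      \sum_(d <- cuts b | Q2 b d) word d.1 ⊠ word d.2) else 0)
   = \sum_(d <- cuts b) if Q1 a c && Q2 b d then
      vmul ((word c.1 ⊠ word c.2) ⊗ (word d.1 ⊠ word d.2)) else 0.
  case: ifP => _; last by rewrite big1.
  by rewrite hten_sumr (linear_big (@hmul_vprod_linear _ _)) -big_mkcond.
apply: eq_big_seq => d dP; rewrite PQ //; case: ifP => // _.
case: c d cP dP => [x y] [x' y'] /cutsP[s1 _] /cutsP[s2 _].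
by rewrite vmulU.
Qed.

Definition all_cuts w (c : seq ncpart * seq ncpart) := true.

(** For w = ∅^q π w' with π non-empty, the upper word starts with ∅^q followed by U_0, so the
    positions agree exactly when U_0 is non-empty, that is, when 1 ∈ U. *)
Definition prec_plus_cuts w (c : seq ncpart * seq ncpart) :=
  first_nontrivial c.2 != first_nontrivial w.

Definition succ_plus_cuts w (c : seq ncpart * seq ncpart) :=
  first_nontrivial c.2 == first_nontrivial w.

(** The excluded cut with trivial upper part is the term [w ⊠ 1_m]; in [succ_cuts] the excluded one
    is [1_n ⊠ w]. *)
Definition prec_cuts w (c : seq ncpart * seq ncpart) :=
  ~~ trivial_word c.2 && prec_plus_cuts w c.

Definition succ_cuts w (c : seq ncpart * seq ncpart) :=
  ~~ trivial_word c.1 && succ_plus_cuts w c.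

Definition red_cuts w (c : seq ncpart * seq ncpart) :=
  ~~ trivial_word c.1 && ~~ trivial_word c.2.

Lemma nc_coprodU w : nc_coprod (word w) = cut_coprod all_cuts (word w).
Proof.
rewrite cut_coprodU /nc_coprod /words_ext lin_extU.
elim: w => [|pi w IH].
  by rewrite /= lin_extU /= lin_extU big_cuts_nil.
rewrite -[LHS]/(vmul ((\sum_(L <- lowersets pi) cut_tensor K pi L) ⊗ foldr _ _ w)).
rewrite IH big_cuts_cons hten_suml.
rewrite (linear_big (@hmul_vprod_linear _ _)) [RHS]big_map.
rewrite [RHS]big_seq [LHS]big_seq; apply: eq_bigr => L Ll.
rewrite hten_sumr (linear_big (@hmul_vprod_linear _ _)).
apply: eq_big_seq => -[x y] /cutsP[sy _]; rewrite /cut_tensor vmulU //.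
by rewrite inw1 size_cut_up.
Qed.

Lemma nc_coprodE : @nc_coprod K =1 cut_coprod all_cuts.
Proof.
by apply: eq_linear => [||w]; [exact: lin_ext_is_linear..|exact: nc_coprodU].
Qed.

End Operations.

(** * The half-coproducts, the bialgebra and the PROS *)

Section HalfCoproducts.
Variable K : fieldType.
Local Notation TNC := (words NC).
Local Notation TNCalg := (words_alg K NC).
Local Notation word w := (<< (w : TNC) >> : vect K TNC).
Local Notation vmul := (hmul (vprod_alg TNCalg TNCalg)).
Local Notation Delta := (@nc_coprod K).
Local Notation one := (@nc_one K).
Implicit Types (a b w : seq ncpart).

Lemma nontrivial_offdiag (u : vect K TNC) w :
  offdiag u -> w \in msupp u -> ~~ trivial_word w.
Proof. by move=> ou /ou; rewrite -size_inw. Qed.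

(** If the upper part y of the cut of a is trivial, its length is at least the length of a and so
    exceeds the first non-trivial position of a. Then both tests fail, whatever follows. *)
Lemma first_nontrivial_cat2 a b c d : ~~ trivial_word a ->
  c \in cuts a -> d \in cuts b ->
  (first_nontrivial (cat2 c d).2 == first_nontrivial (a ++ b))
  = (first_nontrivial c.2 == first_nontrivial a).
Proof.
case: c d => [x y] [x' y'] ta /cutsP[sy ea] _ /=.
rewrite !first_nontrivial_cat (negbTE ta); case: ifP => // ty.
rewrite (first_nontrivial_trivial ty).
have lt : (first_nontrivial a < size y)%N.
  rewrite -sy; apply: leq_trans (size_le_inw x).
  by rewrite -(size_gap_inserts x y) ea first_nontrivial_lt.
by rewrite !gtn_eqF // (leq_trans lt) ?leq_addr.
Qed.

Lemma first_nontrivial_nseq_cat2 n b c d : c \in cuts (nseq n nc0) ->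
  (first_nontrivial (cat2 c d).2 == first_nontrivial (nseq n nc0 ++ b))
  = (first_nontrivial d.2 == first_nontrivial b).
Proof.
case: c d => [x y] [x' y'] /cutsP[sy e] /=.
have := trivial_gap_inserts sy; rewrite e trivial_nseq => /esym/andP[tx ty].
have sx : size x = n by rewrite -(size_gap_inserts x y) e size_nseq.
have sy' : size y = n by rewrite -sy -sx; apply/esym/eqP; rewrite size_inw.
by rewrite !first_nontrivial_cat trivial_nseq ty sy' size_nseq eqn_add2l.
Qed.

Lemma cut_coprod_nseq n : cut_coprod (@all_cuts) (one n) = one n ⊠ one n.
Proof. by rewrite /nc_one cut_coprodU cuts_nseq. Qed.

Lemma first_nontrivial_split w : ~~ trivial_word w ->
  exists pi w', pi != nc0 /\ w = nseq (first_nontrivial w) nc0 ++ pi :: w'.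
Proof.
elim: w => // pi w IH; rewrite first_nontrivial_cons /=.
case: (eqVneq pi nc0) => [->|nz _] /=; last by exists pi, w.
by move=> /IH[pi' [w' [nz e]]]; exists pi', w'; split=> //; rewrite -e.
Qed.

Section HalfPlus.
Variables (d : ncpart -> vect K (TNC ⊠ TNC)) (R : bool -> bool).
Hypothesis dE : forall pi, pi != nc0 ->
  d pi = \sum_(c <- letter_cuts pi | R (nth nc0 c.2 0 != nc0))
           word c.1 ⊠ word c.2.

(** [R] is [negb] for ≺ and [id] for ≻; its argument is the truth value of 1 ∈ U. *)
Let R_cuts w (c : seq ncpart * seq ncpart) :=
  R (first_nontrivial c.2 == first_nontrivial w).

Lemma half_letter pi : pi != nc0 -> cut_coprod R_cuts (word [:: pi]) = d pi.
Proof.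
move=> nz; rewrite dE // cut_coprodU big_mkcond [RHS]big_mkcond big_cuts1.
apply: eq_big_seq => -[x y] /letter_cutsP[sy e].
rewrite /R_cuts first_nontrivial_cons (negbTE nz).
rewrite -[(x, y).2]/y.
suff -> : (first_nontrivial y == 0%N) = (nth nc0 y 0 != nc0) by [].
case: y sy e => [|p y] sy e; last first.
  by rewrite first_nontrivial_cons -[nth _ _ _]/p; case: (p == nc0).
(* On an empty y the two tests disagree through their default values. This case cannot occur: the
   lower word would be empty too, and nothing would compose to [pi]. *)
have := size_le_inw x; rewrite sy leqn0 => /eqP/size0nil ex.
by move: (congr1 size e); rewrite size_gap_inserts ex.
Qed.

(** The definition multiplies three factors, for ∅^q, for the first non-empty letter and for the
    rest; only the middle one carries the condition. *)
Lemma nc_half_plusU w : ~~ trivial_word w ->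
  nc_half_plus d (word w) = cut_coprod R_cuts (word w).
Proof.
move=> tw; have [pi [w' [nz ew]]] := first_nontrivial_split tw.
rewrite /nc_half_plus lin_extU -/(first_nontrivial w).
have -> : drop (first_nontrivial w) w = pi :: w'.
  by rewrite {2}ew drop_size_cat ?size_nseq.
set q := first_nontrivial w in ew *.
have -> : w = (nseq q nc0 ++ [:: pi]) ++ w' by rewrite -catA.
have ta : ~~ trivial_word (nseq q nc0 ++ [:: pi]).
  by rewrite /trivial_word all_cat /= (negbTE nz) /= andbF.
rewrite (@cut_coprod_mul _ R_cuts R_cuts all_cuts) => [|c e cP eP]; last first.
  by rewrite /R_cuts first_nontrivial_cat2 // andbT.
rewrite (@cut_coprod_mul _ R_cuts all_cuts R_cuts) => [|c e cP eP]; last first.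
  by rewrite /R_cuts first_nontrivial_nseq_cat2.
by rewrite cut_coprod_nseq -nc_coprodE half_letter.
Qed.

End HalfPlus.

Lemma letter_cuts_sum pi (S : pred {fset {fset nat}}) (R : pred (seq ncpart)) :
  {in lowersets pi, forall L, S L = R (cut_up pi L)} ->
  \sum_(L <- lowersets pi | S L) cut_tensor K pi L
  = \sum_(c <- letter_cuts pi | R c.2) word c.1 ⊠ word c.2.
Proof.
move=> SR; rewrite big_map big_seq_cond [RHS]big_seq_cond; apply: eq_bigl => L /=.
by apply: andb_id2l => /SR.
Qed.

Lemma one_in_low pi L : pi != nc0 -> L \in lowersets pi ->
  (1%N \in points L) = (nth nc0 (cut_up pi L) 0 == nc0).
Proof.
move=> nz Ll; rewrite -(one_in_inserted_low (size_cut_up Ll)).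
  by rewrite inserted_low_cut.
by rewrite gap_insert_cut.
Qed.

Lemma nc_prec_plusU w : ~~ trivial_word w ->
  nc_prec_plus (word w) = cut_coprod prec_plus_cuts (word w).
Proof.
apply: (nc_half_plusU (R := negb)) => pi nz.
rewrite /nc_prec_plus_letter (letter_cuts_sum (R := fun y => nth nc0 y 0 == nc0)).
  by apply: eq_bigl => c; rewrite negbK.
by move=> L Ll; exact: one_in_low.
Qed.

Lemma nc_succ_plusU w : ~~ trivial_word w ->
  nc_succ_plus (word w) = cut_coprod succ_plus_cuts (word w).
Proof.
apply: (nc_half_plusU (R := id)) => pi nz.
apply: (letter_cuts_sum (R := fun y => nth nc0 y 0 != nc0)) => L Ll.
by congr (~~ _); exact: one_in_low.
Qed.

Lemma cuts_trivial w c : c \in cuts w ->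
  trivial_word w = trivial_word c.1 && trivial_word c.2.
Proof. by case: c => [x y] /cutsP[sy <-]; exact: trivial_gap_inserts. Qed.

Lemma first_nontrivial_up w c : ~~ trivial_word w -> c \in cuts w ->
  trivial_word c.2 -> first_nontrivial c.2 != first_nontrivial w.
Proof.
case: c => [x y] tw /cutsP[/= sy e] ty; rewrite first_nontrivial_trivial // -sy gtn_eqF //.
by apply: leq_trans (size_le_inw x); rewrite -(size_gap_inserts x y) e first_nontrivial_lt.
Qed.

(** A trivial lower part has the same length as the upper word, so its first position, which is that
    length, never wins the minimum over the upper one. *)
Lemma first_nontrivial_low w c : c \in cuts w ->
  trivial_word c.1 -> first_nontrivial c.2 == first_nontrivial w.
Proof.
case: c => [x y] /cutsP[/= sy <-] tx; rewrite find_gap_inserts //.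
have : (first_nontrivial y <= first_nontrivial x)%N.
  rewrite (first_nontrivial_trivial tx); move: tx; rewrite -size_inw sy => /eqP ->.
  exact: find_size.
by move/minn_idPr->.
Qed.

Lemma big_cuts_if (V : nmodType) w P Q (F : seq ncpart * seq ncpart -> V) :
  {in cuts w, P =1 Q} ->
  \sum_(c <- cuts w | P c) F c = \sum_(c <- cuts w | Q c) F c.
Proof.
move=> PQ; rewrite big_seq_cond [RHS]big_seq_cond; apply: eq_bigl => c.
by apply: andb_id2l => /PQ.
Qed.

Lemma cut_coprod_prec_plus w : ~~ trivial_word w ->
  cut_coprod prec_plus_cuts (word w)
  = cut_coprod prec_cuts (word w) + word w ⊠ one (inw w).
Proof.
move=> tw; rewrite !cut_coprodU (bigID (fun c => trivial_word c.2)) [LHS]addrC.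
congr (_ + _); first by apply: eq_bigl => c; rewrite andbC.
rewrite (@big_cuts_if _ _ _ (fun c => trivial_word c.2)) ?big_cuts_trivial_up //.
by move=> c cw; apply: andb_idl => tc; exact: first_nontrivial_up.
Qed.

Lemma cut_coprod_succ_plus w :
  cut_coprod succ_plus_cuts (word w)
  = cut_coprod succ_cuts (word w) + one (size w) ⊠ word w.
Proof.
rewrite !cut_coprodU (bigID (fun c => trivial_word c.1)) [LHS]addrC.
congr (_ + _); first by apply: eq_bigl => c; rewrite andbC.
rewrite (@big_cuts_if _ _ _ (fun c => trivial_word c.1)) ?big_cuts_trivial_low //.
by move=> c cw; apply: andb_idl => tc; exact: first_nontrivial_low.
Qed.

(** For non-trivial w the cuts with trivial lower part and with trivial upper part are different, so
    two terms split off; for trivial w they coincide. *)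
Lemma cut_coprod_red w : ~~ trivial_word w ->
  cut_coprod all_cuts (word w)
  = cut_coprod red_cuts (word w) + word w ⊠ one (inw w) + one (size w) ⊠ word w.
Proof.
move=> tw; rewrite !cut_coprodU (bigID (fun c => trivial_word c.1)) [LHS]addrC.
congr (_ + _); last exact: big_cuts_trivial_low.
rewrite (bigID (fun c => trivial_word c.2)) addrC /=; congr (_ + _).
rewrite -(big_cuts_trivial_up w (fun c => word c.1 ⊠ word c.2)).
apply: big_cuts_if => c cw; apply: andb_idl => t2.
by apply: contra tw => t1; rewrite (cuts_trivial cw) t1.
Qed.

Lemma cut_coprod0 P w : trivial_word w ->
  (forall c, trivial_word c.1 -> trivial_word c.2 -> ~~ P w c) ->
  cut_coprod P (word w) = 0.
Proof.
move=> tw nP; rewrite cut_coprodU big_seq_cond big_pred0 // => c.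
apply/andP => -[cw]; apply/negP.
by move: tw; rewrite (cuts_trivial cw) => /andP[]; exact: nP.
Qed.

Lemma prec_cuts_trivial w : trivial_word w -> cut_coprod prec_cuts (word w) = 0.
Proof. by move=> tw; apply: cut_coprod0 => // c _ t2; rewrite /prec_cuts t2. Qed.

Lemma succ_cuts_trivial w : trivial_word w -> cut_coprod succ_cuts (word w) = 0.
Proof. by move=> tw; apply: cut_coprod0 => // c t1; rewrite /succ_cuts t1. Qed.

Lemma red_cuts_trivial w : trivial_word w -> cut_coprod red_cuts (word w) = 0.
Proof. by move=> tw; apply: cut_coprod0 => // c t1; rewrite /red_cuts t1. Qed.

Lemma nc_precE : @nc_prec K =1 cut_coprod prec_cuts.
Proof.
apply: eq_linear => [||w]; [exact: lin_ext_is_linear..|].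
rewrite /nc_prec lin_extU -/(trivial_word w); case: ifPn => [/prec_cuts_trivial->//|tw].
by rewrite nc_prec_plusU // cut_coprod_prec_plus // addrK.
Qed.

Lemma nc_succE : @nc_succ K =1 cut_coprod succ_cuts.
Proof.
apply: eq_linear => [||w]; [exact: lin_ext_is_linear..|].
rewrite /nc_succ lin_extU -/(trivial_word w); case: ifPn => [/succ_cuts_trivial->//|tw].
by rewrite nc_succ_plusU // cut_coprod_succ_plus // addrK.
Qed.

Local Notation red := (@red_coprod K TNCalg Delta one).

Lemma red_coprodE : red =1 cut_coprod red_cuts.
Proof.
apply: eq_linear => [||w]; [exact: lin_ext_is_linear..|].
rewrite /red_coprod lin_extU size_inw; case: ifPn => [/red_cuts_trivial->//|tw].
by rewrite nc_coprodE cut_coprod_red // [outp w]/= addrK addrK.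
Qed.

Lemma nc_counitU w :
  @nc_counit K (word w)
  = if trivial_word w then << (size w : unit_v) >> else 0.
Proof.
rewrite /nc_counit /words_ext lin_extU; elim: w => [|pi w IH]; first by rewrite /= lin_extU.
rewrite -[LHS]/(hmul (@unit_v_alg K)
  ((if pi == nc0 then << (1%N : unit_v) >> else 0) ⊗ foldr _ _ w)) IH /trivial_word /=.
case: (pi == nc0); last by rewrite hten0l linear0.
case: (all _ w); last by rewrite hten0r linear0.
by rewrite htenU lin_extU.
Qed.

Lemma hmul_wordsP (P : coll) (x : (words P ⊗ words P)%bic) :
  hmul (words_alg K P) << x >> = << (x.1 ++ x.2 : words P) >>.
Proof. by rewrite /= lin_extU. Qed.

Lemma hunit_wordsU (P : coll) (x : unit_h) :
  hunit (words_alg K P) << x >> = << ([::] : words P) >>.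
Proof. by rewrite /= lin_extU. Qed.

Lemma hunit_vprodU (A B : halg K) (x : unit_h) :
  hunit (vprod_alg A B) << x >> = hunit A << x >> ⊠ hunit B << x >>.
Proof. by rewrite /= lin_extU. Qed.

Lemma hunit_unit_vU (x : unit_h) :
  hunit (@unit_v_alg K) << x >> = << (0%N : unit_v) >>.
Proof. by rewrite /= lin_extU. Qed.

Lemma hmul_unit_vU (x : (unit_v ⊗ unit_v)%bic) :
  hmul (@unit_v_alg K) << x >> = << ((x.1 + x.2)%N : unit_v) >>.
Proof. by rewrite /= lin_extU. Qed.

Lemma words_halg (P : coll) : is_halg (words_alg K P).
Proof.
split.
- apply: bimorphism_lin_ext => -[a b]; apply: homogU; rewrite /outp /inp /=.
    exact: size_cat.
  by rewrite map_cat sumn_cat.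
- by apply: bimorphism_lin_ext => x; apply: homogU.
- apply: eq_linear => [||[[a b] c]].
  + by apply: linear_comp; apply: lin_ext_is_linear.
  + by apply: linear_comp3; apply: lin_ext_is_linear.
  rewrite !comp_apply.
  rewrite hmapU.
  rewrite hmul_wordsP.
  rewrite hmul_wordsU.
  rewrite /hassoc lin_extU.
  rewrite !htenU.
  rewrite hmapU.
  rewrite hmul_wordsP.
  rewrite hmul_wordsU.
  by rewrite catA.
- apply: eq_linear => [||[x a]]; [|exact: lin_ext_is_linear|].
    by apply: linear_comp; apply: lin_ext_is_linear.
  by rewrite /hlunit comp_apply hmapU hunit_wordsU lin_extU hmul_wordsU.
- apply: eq_linear => [||[a x]]; [|exact: lin_ext_is_linear|].
    by apply: linear_comp; apply: lin_ext_is_linear.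
  by rewrite /hrunit comp_apply hmapU hunit_wordsU lin_extU hmul_wordsU cats0.
Qed.

Lemma nc_coprod_mul : Delta \o hmul TNCalg =1 vmul \o hmap Delta Delta.
Proof.
apply: eq_linear => [||[a b]].
- by apply: linear_comp; apply: lin_ext_is_linear.
- by apply: linear_comp; [exact: hmul_vprod_linear|exact: lin_ext_is_linear].
rewrite !comp_apply hmapU hmul_wordsP !nc_coprodE.
exact: cut_coprod_mul.
Qed.

Lemma nc_bialgebra : is_bialgebra (A := TNCalg) Delta (@nc_counit K).
Proof.
split.
- exact: words_halg.
- split.
  + apply: (@eq_bimorphism K TNC (TNC ⊠ TNC) _ _ (@nc_coprodE K)).
    exact: cut_coprod_bimorphism.
  + exact: nc_coprod_mul.
  + apply: eq_linear => [||[]].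
    * by apply: linear_comp; apply: lin_ext_is_linear.
    * exact: lin_ext_is_linear.
    by rewrite comp_apply hunit_vprodU !hunit_wordsU nc_coprodE cut_coprodU big_cuts_nil.
- split.
  + apply: (eq_bimorphism (g := lin_ext (fun w : TNC =>
      if trivial_word w then << (size w : unit_v) >> else 0))).
      apply: eq_linear => [||w]; [exact: lin_ext_is_linear..|].
      by rewrite lin_extU nc_counitU.
    apply: bimorphism_lin_ext => w; case: ifPn => tw; last exact: homog0.
    by apply: homogU => //; apply/eqP; rewrite size_inw.
  + apply: eq_linear => [||[a b]].
    * by apply: linear_comp; apply: lin_ext_is_linear.
    * by apply: linear_comp; apply: lin_ext_is_linear.
    rewrite !comp_apply hmapU hmul_wordsP !nc_counitU /trivial_word all_cat size_cat.
    case: all; last by rewrite hten0l /= linear0.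
    case: all; last by rewrite hten0r /= linear0.
    by rewrite htenU hmul_unit_vU.
  + apply: eq_linear => [||[]].
    * by apply: linear_comp; apply: lin_ext_is_linear.
    * exact: lin_ext_is_linear.
    by rewrite comp_apply hunit_wordsU hunit_unit_vU nc_counitU.
- move=> u; have -> : Delta = cut_coprod all_cuts by apply/funext; exact: nc_coprodE.
  exact: cut_coprod_assoc.
- apply: eq_linear => [||w] //.
    by apply: linear_comp3; apply: lin_ext_is_linear.
  rewrite /= nc_coprodE vmap_cut_coprod (linear_big (@vlunit_linear K TNC)).
  (* The counit leaves only the cut with trivial lower part, whose upper part is w. *)
  rewrite -[RHS](big_cuts_trivial_low w (fun c => word c.2)) [RHS]big_mkcond.
  apply: eq_big_seq => -[x y] /cutsP[sy _] /=; rewrite nc_counitU.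
  case: ifPn => [tx|_]; last by rewrite vten0l /vlunit linear0.
  by apply: (@vlunitU K TNC (size x) y); rewrite /= -sy; apply/eqP; rewrite size_inw.
- apply: eq_linear => [||w] //.
    by apply: linear_comp3; apply: lin_ext_is_linear.
  rewrite /= nc_coprodE vmap_cut_coprod (linear_big (@vrunit_linear K TNC)).
  rewrite -[RHS](big_cuts_trivial_up w (fun c => word c.1)) [RHS]big_mkcond.
  apply: eq_big_seq => -[x y] /cutsP[sy _] /=; rewrite nc_counitU.
  case: ifPn => [tx|_]; last by rewrite vten0r /vrunit linear0.
  exact: (@vrunitU K TNC (size y) x).
Qed.

Local Notation nabla := (@nc_nabla K).
Local Notation eta := (@nc_eta K).

Lemma nc_nablaU a b : inw a = size b ->
  nabla (word a ⊠ word b) = word (gap_inserts a b).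
Proof.
move=> /eqP sb; rewrite vtenU; case: insubP => [z _ ez|]; last by rewrite /= sb.
by rewrite /nc_nabla lin_extU ez.
Qed.

Lemma nc_nabla_linear : linear nabla.
Proof. exact: lin_ext_is_linear. Qed.

Lemma nc_etaU n : eta << (n : unit_v) >> = one n.
Proof. by rewrite /nc_eta lin_extU. Qed.

Lemma nc_nabla_vmul (s t : (TNC ⊠ TNC)%bic) :
  nabla (vmul (<< s >> ⊗ << t >>)) = hmul TNCalg (nabla << s >> ⊗ nabla << t >>).
Proof.
have [a [b [sb ->]]] := @vten_basis K TNC TNC s.
have [a' [b' [sb' ->]]] := @vten_basis K TNC TNC t.
transitivity (nabla (word (a ++ a') ⊠ word (b ++ b'))).
  by congr nabla; exact: vmulU.
have sbb : inw (a ++ a') = size (b ++ b') by rewrite inw_cat size_cat sb sb'.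
transitivity (word (gap_inserts (a ++ a') (b ++ b'))); first exact: nc_nablaU sbb.
transitivity (hmul TNCalg (word (gap_inserts a b) ⊗ word (gap_inserts a' b'))).
  by rewrite hmul_wordsU (gap_inserts_cat _ _ sb).
exact: (congr2 (fun x y => hmul TNCalg (x ⊗ y))
  (esym (nc_nablaU sb)) (esym (nc_nablaU sb'))).
Qed.

(* Matching up to conversion would otherwise unfold tensors of distinct words
   down to finitely supported functions. *)
#[local] Opaque vten hten mkmalgU nc_nabla.

Lemma nc_pros : is_pros (A := TNCalg) nabla eta.
Proof.
split.
- exact: words_halg.
- split.
  + apply: bimorphism_lin_ext => -[[a b] ab]; have /eqP /= sb := ab.
    apply: homogU; rewrite /outp /inp /=; first exact: size_gap_inserts.
    exact: (inw_gap_inserts sb).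
  + apply: eq_linear_hten => [||s t].
    * by apply: (linear_comp nc_nabla_linear); apply: hmul_vprod_linear.
    * by apply: linear_comp; apply: lin_ext_is_linear.
    by rewrite !comp_apply hmap_hten; exact: nc_nabla_vmul.
  + apply: eq_linear => [||[]].
    * by apply: linear_comp; apply: lin_ext_is_linear.
    * exact: lin_ext_is_linear.
    by rewrite comp_apply hunit_vprodU !hunit_wordsU nc_nablaU.
- split.
  + by apply: bimorphism_lin_ext => n; apply: homogU; rewrite ?inw_nseq //= size_nseq.
  + apply: eq_linear => [||[m n]].
    * by apply: linear_comp; apply: lin_ext_is_linear.
    * by apply: linear_comp; apply: lin_ext_is_linear.
    by rewrite !comp_apply hmapU !nc_etaU hmul_unit_vU htenU hmul_wordsP nc_etaU /nc_one nseqD.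
  + apply: eq_linear => [||[]].
    * by apply: linear_comp; apply: lin_ext_is_linear.
    * exact: lin_ext_is_linear.
    by rewrite comp_apply hunit_unit_vU hunit_wordsU nc_etaU.
- apply: eq_linear_vten => [||t c].
  + by apply: linear_comp; apply: lin_ext_is_linear.
  + by apply: linear_comp3; apply: lin_ext_is_linear.
  pose a := (val t).1; pose b := (val t).2 => sc.
  have sb : inw a = size b by apply/eqP; exact: (valP t).
  have et : << t >> = word a ⊠ word b :> vect K _ by rewrite vtenU_val.
  have bc : inw b = size c by [].
  (* [vmapU] expects basis elements on both sides, so b ⊠ c is named as the basis element s. *)
  have [s [es [os _]]] := @basis_vten K TNC TNC b c bc.
  have ea : inw a = outp s by rewrite os.
  have nt : nabla << t >> = word (gap_inserts a b) by rewrite et nc_nablaU.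
  have ns : nabla << s >> = word (gap_inserts b c) by rewrite es nc_nablaU.
  transitivity (word (gap_inserts (gap_inserts a b) c)).
    by rewrite comp_apply (vmapU nabla id sc) nt nc_nablaU // inw_gap_inserts.
  rewrite !comp_apply et vassocU -es (vmapU id nabla ea) ns.
  by rewrite nc_nablaU ?gap_insertsA // size_gap_inserts.
- apply: eq_linear_vten => [||n w e].
  + by apply: linear_comp; apply: lin_ext_is_linear.
  + exact: lin_ext_is_linear.
  rewrite [LHS]/= vmapU // vlunitU // nc_etaU nc_nablaU ?inw_nseq //.
  by rewrite gap_inserts1l.
- apply: eq_linear_vten => [||w n e].
  + by apply: linear_comp; apply: lin_ext_is_linear.
  + exact: lin_ext_is_linear.
  rewrite [LHS]/= vmapU // vrunitU // nc_etaU nc_nablaU ?size_nseq //.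
  by rewrite gap_inserts1r.
Qed.
End HalfCoproducts.

(** * Convolution inverses of multiplicative functions *)

Section Characters.
Variable K : fieldType.
Implicit Types (a b w : seq ncpart) (f g h : ncpart -> K).

Definition char f w : K := \prod_(pi <- w) f pi.

Lemma char_letter f pi : char f [:: pi] = f pi.
Proof. exact: big_seq1. Qed.

Lemma char_cat f a b : char f (a ++ b) = char f a * char f b.
Proof. exact: big_cat. Qed.

Lemma char_trivial f w : f nc0 = 1 -> trivial_word w -> char f w = 1.
Proof.
by move=> f1 /allP tw; rewrite /char big1_seq // => pi /andP[_ /tw /eqP->].
Qed.

(** A cut of a word is a choice of one cut per letter, so the sum factors into a product over the
    letters. *)
Lemma convolution_word f g :
  (forall pi, \sum_(c <- letter_cuts pi) char f c.1 * char g c.2 = (pi == nc0)%:R) ->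
  forall w, \sum_(c <- cuts w) char f c.1 * char g c.2 = (trivial_word w)%:R.
Proof.
move=> fg; elim=> [|pi w IH]; first by rewrite big_cuts_nil /char !big_nil mulr1.
rewrite big_cuts_cons [RHS]/= -mulnb natrM -IH -fg mulr_suml; apply: eq_bigr => c _.
rewrite mulr_sumr; apply: eq_bigr => d _.
by rewrite !char_cat mulrACA.
Qed.

Section LeftInverse.
Variable f : ncpart -> K.

(* The first argument bounds the depth of the recursion. *)
Fixpoint left_inverse_rec n pi : K :=
  if n is n'.+1 then
    if pi == nc0 then 1 else
    - \sum_(c <- letter_cuts pi | ~~ trivial_word c.2)
        char (left_inverse_rec n') c.1 * char f c.2
  else 1.

Definition left_inverse pi := left_inverse_rec (npoints pi) pi.

(** The descent behind the recursion: a non-trivial upper part takes at least one point away from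
    the lower one. *)
Lemma letter_cut_low pi c : c \in letter_cuts pi -> ~~ trivial_word c.2 ->
  exists2 lam, c.1 = [:: lam] & (npoints lam < npoints pi)%N.
Proof.
case: c => [a b] /letter_cutsP[sb e]; rewrite -[(a, b).2]/b => tb.
have : size a = 1%N by rewrite -(size_gap_inserts a b) e.
case: a sb e => [|lam []] // sb e _; exists lam => //.
rewrite -ltnS -(inw1 pi) -(inw1 lam) sb -e inw_gap_inserts //.
by rewrite ltn_neqAle size_inw tb size_le_inw.
Qed.

Lemma left_inverse_recE n pi : (npoints pi <= n)%N ->
  left_inverse_rec n pi = left_inverse pi.
Proof.
suff H m k lam : (npoints lam <= m)%N -> (npoints lam <= k)%N ->
    left_inverse_rec m lam = left_inverse_rec k lam by move=> le; apply: H.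
elim: m k lam => [|m IH] [|k] lam //=; try rewrite leqn0 npoints_eq0.
- by move=> ->.
- by move=> _ ->.
move=> lem lek; case: ifP => // _; congr (- _).
rewrite big_seq_cond [RHS]big_seq_cond; apply: eq_bigr => c /andP[cP tc].
have [mu -> lt] := letter_cut_low cP tc; congr (_ * _).
by rewrite !char_letter; apply: IH; rewrite -ltnS (leq_trans lt).
Qed.

Lemma left_inverse0 : left_inverse nc0 = 1.
Proof. by []. Qed.

Lemma left_inverseE pi : pi != nc0 ->
  left_inverse pi
  = - \sum_(c <- letter_cuts pi | ~~ trivial_word c.2)
        char left_inverse c.1 * char f c.2.
Proof.
move=> nz; rewrite {1}/left_inverse; case en: (npoints pi) => [|n] /=.
  by rewrite -npoints_eq0 en in nz.
rewrite (negbTE nz); congr (- _).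
rewrite big_seq_cond [RHS]big_seq_cond; apply: eq_bigr => c /andP[cP tc].
have [mu -> lt] := letter_cut_low cP tc; congr (_ * _).
by rewrite !char_letter; apply: left_inverse_recE; rewrite -ltnS -en.
Qed.

(** The cut with trivial upper part contributes [left_inverse pi] itself, which the recursion chose
    to cancel all other cuts. Multiplicativity then passes from letters to words. *)
Lemma left_inverseP : f nc0 = 1 -> forall w,
  \sum_(c <- cuts w) char left_inverse c.1 * char f c.2 = (trivial_word w)%:R.
Proof.
move=> f1; apply: convolution_word => pi.
rewrite (bigID (fun c => trivial_word c.2)) /=.
have -> : \sum_(c <- letter_cuts pi | trivial_word c.2)
    char left_inverse c.1 * char f c.2 = left_inverse pi.
  rewrite big_mkcond -big_cuts1 -big_mkcond big_cuts_trivial_up.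
  by rewrite char_letter (char_trivial f1 (trivial_nseq _)) mulr1.
case: (eqVneq pi nc0) => [->|nz]; last by rewrite left_inverseE // addNr.
rewrite left_inverse0 big_seq_cond big_pred0 ?addr0 // => c; apply/andP => -[cP tc].
by have [mu _] := letter_cut_low cP tc.
Qed.

End LeftInverse.

Definition antipode_coef := left_inverse (fun=> 1 : K).

Lemma char1 w : char (fun=> 1) w = 1.
Proof. exact: big1. Qed.

Lemma antipode_coefl w :
  \sum_(c <- cuts w) char antipode_coef c.1 = (trivial_word w)%:R.
Proof.
rewrite -(@left_inverseP (fun=> 1)) //; apply: eq_bigr => c _.
by rewrite char1 mulr1.
Qed.

(* If h is a left inverse of the antipode, then h = h * (S * 1) = (h * S) * 1 = 1. *)
Lemma antipode_coefr w :
  \sum_(c <- cuts w) char antipode_coef c.2 = (trivial_word w)%:R.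
Proof.
pose h := left_inverse antipode_coef.
have hS := @left_inverseP antipode_coef (left_inverse0 _).
have h1 v : char h v = 1.
  transitivity (\sum_(c <- cuts v) \sum_(d <- cuts c.2) char h c.1 * char antipode_coef d.1).
    rewrite -(big_cuts_trivial_up v (fun c => char h c.1)) big_mkcond.
    apply: eq_bigr => c _; rewrite -mulr_sumr antipode_coefl.
    by case: trivial_word; rewrite ?mulr1 ?mulr0.
  rewrite -(big_cuts_assoc v (fun x y z => char h x * char antipode_coef y)).
  rewrite -[RHS](big_cuts_trivial_low v (fun=> 1)) [RHS]big_mkcond.
  by apply: eq_bigr => c _; rewrite hS; case: trivial_word.
by rewrite -hS; apply: eq_bigr => c _; rewrite h1 mul1r.
Qed.

End Characters.

(** * The antipode, co-nilpotency and the unshuffle relations *)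

Section Hopf.
Variable K : fieldType.
Local Notation TNC := (words NC).
Local Notation TNCalg := (words_alg K NC).
Local Notation word w := (<< (w : TNC) >> : vect K TNC).
Local Notation vmul := (hmul (vprod_alg TNCalg TNCalg)).
Local Notation Delta := (@nc_coprod K).
Local Notation eps := (@nc_counit K).
Local Notation one := (@nc_one K).
Local Notation nabla := (@nc_nabla K).
Local Notation eta := (@nc_eta K).
Implicit Types (a b w : seq ncpart).

(* Every cut (L, U) of pi satisfies nabla (L ⊠ U) = pi, so a diagonal map can
   be an antipode. *)
Definition nc_antipode : vect K TNC -> vect K TNC :=
  lin_ext (fun w : TNC => char (@antipode_coef K) w *: word w).

Lemma nc_antipodeU w : nc_antipode (word w) = char (@antipode_coef K) w *: word w.
Proof. by rewrite /nc_antipode lin_extU. Qed.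

Lemma nc_antipode_bimorphism : bimorphism nc_antipode.
Proof. by apply: bimorphism_lin_ext => w; apply: homogZ; apply: homogU. Qed.

Lemma nc_antipode_linear : linear nc_antipode.
Proof. exact: lin_ext_is_linear. Qed.

#[local] Opaque nc_antipode.

Lemma nc_eta_counitU w : eta (eps (word w)) = (trivial_word w)%:R *: word w.
Proof.
rewrite nc_counitU; case: ifP => [tw|_]; last by rewrite scale0r /nc_eta linear0.
by rewrite nc_etaU scale1r /nc_one -(trivial_wordP _ tw).
Qed.

Lemma nc_antipode_mul :
  nc_antipode \o hmul TNCalg =1 hmul TNCalg \o hmap nc_antipode nc_antipode.
Proof.
apply: eq_linear_hten => [||a b].
- by apply: linear_comp; [exact: nc_antipode_linear|exact: lin_ext_is_linear].
- by apply: linear_comp; apply: lin_ext_is_linear.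
rewrite !comp_apply hmap_hten.
transitivity (char (@antipode_coef K) (a ++ b) *: word (a ++ b)).
  exact: etrans (congr1 nc_antipode (hmul_wordsU K a b)) (nc_antipodeU _).
transitivity (hmul TNCalg ((char (@antipode_coef K) a *: word a)
                            ⊗ (char (@antipode_coef K) b *: word b))).
  rewrite htenZl htenZr !(linear_scale (@hmul_words_linear K NC)) hmul_wordsU.
  by rewrite char_cat scalerA.
exact: (congr2 (fun x y => hmul TNCalg (x ⊗ y))
  (esym (nc_antipodeU a)) (esym (nc_antipodeU b))).
Qed.

Lemma nabla_antipodel : nabla \o vmap nc_antipode id \o Delta =1 eta \o eps.
Proof.
apply: eq_linear => [||w].
- by apply: linear_comp3; apply: lin_ext_is_linear.
- by apply: linear_comp; apply: lin_ext_is_linear.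
rewrite !comp_apply nc_coprodE vmap_cut_coprod (linear_big (@nc_nabla_linear K)).
rewrite nc_eta_counitU -antipode_coefl scaler_suml.
apply: eq_big_seq => -[a b] /cutsP[sb e].
rewrite nc_antipodeU vtenZl (linear_scale (@nc_nabla_linear K)).
by rewrite nc_nablaU // e.
Qed.

Lemma nabla_antipoder : nabla \o vmap id nc_antipode \o Delta =1 eta \o eps.
Proof.
apply: eq_linear => [||w].
- by apply: linear_comp3; apply: lin_ext_is_linear.
- by apply: linear_comp; apply: lin_ext_is_linear.
rewrite !comp_apply nc_coprodE vmap_cut_coprod (linear_big (@nc_nabla_linear K)).
rewrite nc_eta_counitU -antipode_coefr scaler_suml.
apply: eq_big_seq => -[a b] /cutsP[sb e].
rewrite nc_antipodeU vtenZr (linear_scale (@nc_nabla_linear K)).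
by rewrite nc_nablaU // e.
Qed.

Lemma nc_hopf : is_hopf (A := TNCalg) Delta eps nabla eta nc_antipode.
Proof.
split; [exact: nc_bialgebra|exact: nc_pros|split|..].
- exact: nc_antipode_bimorphism.
- exact: nc_antipode_mul.
- apply: eq_linear => [||[]].
  + by apply: linear_comp; [exact: nc_antipode_linear|exact: lin_ext_is_linear].
  + exact: lin_ext_is_linear.
  by rewrite comp_apply hunit_wordsU nc_antipodeU /char big_nil scale1r.
- exact: nabla_antipodel.
- exact: nabla_antipoder.
Qed.

Local Notation red := (@red_coprod K TNCalg Delta one).

Lemma cuts_weight w c : c \in cuts w ->
  [/\ size c.1 = size w, inw c.1 = size c.2 & inw c.2 = inw w].
Proof.
case: c => [a b] /cutsP[sb <-].
by rewrite size_gap_inserts inw_gap_inserts.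
Qed.

Lemma iter_coprod_linear k : linear (iter_coprod red k).
Proof.
case: k => [|k]; first exact: linear_id.
by apply: linear_comp; apply: lin_ext_is_linear.
Qed.

(** The iteration continues on the lower part. Every reduced cut leaves a point in the upper part,
    so the number of points [inw w - size w] drops at each step. *)
Lemma iter_red_coprod0 k w : (inw w <= size w + k)%N ->
  iter_coprod red k.+1 (word w) = 0.
Proof.
have iterS j u : iter_coprod red j.+1 u = vmap (iter_coprod red j) id (red u) by [].
elim: k w => [|k IH] w le; rewrite iterS red_coprodE.
  rewrite red_cuts_trivial; first by rewrite /vmap linear0.
  by rewrite -size_inw eqn_leq size_le_inw -[size w]addn0.
rewrite vmap_cut_coprod big_seq_cond big1 // => c /andP[cw /andP[_]].
have [s1 s2 s3] := cuts_weight cw; rewrite -size_inw => t2.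
rewrite IH ?vten0l // s1 s2 -ltnS -addnS; apply: leq_trans le.
by rewrite -s3 ltn_neqAle t2 size_le_inw.
Qed.

Lemma cut_coprod_offdiag (P : seq ncpart -> pred (seq ncpart * seq ncpart)) u :
  (forall w c, ~~ trivial_word w -> c \in cuts w -> P w c -> red_cuts w c) ->
  offdiag u -> offdiag2 (cut_coprod (K := K) P u).
Proof.
move=> Pred ou; rewrite (linear_on_basis (cut_coprod_linear _)).
apply: offdiag2_sum => w wu _ z /(fsubsetP (msuppZ_le _ _)); move: z.
rewrite cut_coprodU; apply: offdiag2_sum => c cw Pc z.
have /andP[t1 t2] := Pred w c (nontrivial_offdiag ou wu) cw Pc.
rewrite vtenU; case: insubP => [z' _ ez|_]; last by rewrite msupp0.
rewrite msuppU oner_eq0 inE => /eqP->; rewrite ez.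
by rewrite !size_inw.
Qed.

Lemma nc_conilpotent : is_conilpotent (A := TNCalg) Delta eps one.
Proof.
split.
- exact: nc_bialgebra.
- by move=> n; apply: homogU; rewrite ?inw_nseq // /outp /= size_nseq.
- by move=> n; rewrite /nc_one monalgU_eq0 oner_eq0.
- move=> n u hu; exists u@_(nseq n nc0).
  apply/malgP => w; rewrite mcoeffZ mcoeffU.
  case: (eqVneq w (nseq n nc0)) => [->|nw]; first by rewrite mulr1.
  rewrite mulr0; apply: mcoeff_outdom.
  apply: contra nw => /hu [sw iw].
  by rewrite -sw; apply/eqP/trivial_wordP; rewrite -size_inw iw -sw.
- move=> n u n0 hu; apply/malgP => w; rewrite mcoeff0.
  apply: mcoeff_outdom; apply/negP => /hu [sw iw].
  by have := size_le_inw w; rewrite iw -[size w]/(outp w) sw leqNgt n0.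
- move=> n u n0 hu; apply/malgP => w; rewrite mcoeff0.
  apply: mcoeff_outdom; apply/negP => /hu [/size0nil -> iw].
  by rewrite -iw in n0.
- by move=> n; rewrite nc_coprodE cut_coprod_nseq.
- move=> u; rewrite red_coprodE; exact: cut_coprod_offdiag.
(* A word with n outputs and m inputs has m - n points. *)
- move=> n m u nm hu; exists (m - n)%N.
  rewrite (linear_on_basis (@iter_coprod_linear _)) big1_seq // => w /andP[_ /hu [sw iw]].
  by rewrite iter_red_coprod0 ?scaler0 // iw -leq_subLR -sw.
Qed.

Lemma half_coprod (P : seq ncpart -> pred (seq ncpart * seq ncpart))
    (d : vect K TNC -> vect K (TNC ⊠ TNC)) :
  d =1 cut_coprod P ->
  (forall w, trivial_word w -> cut_coprod (K := K) P (word w) = 0) ->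
  (forall w c, ~~ trivial_word w -> c \in cuts w -> P w c -> red_cuts w c) ->
  is_half_coprod (A := TNCalg) d.
Proof.
move=> /funext -> P0 Pred; split.
- exact: cut_coprod_bimorphism.
- by move=> u; apply: cut_coprod_offdiag.
- move=> n u hu; rewrite (linear_on_basis (cut_coprod_linear _)).
  rewrite big1_seq // => w /andP[_ /hu[sw iw]].
  by rewrite P0 ?scaler0 // -size_inw -[size w]/(outp w) sw iw.
Qed.

Lemma prec_red_cuts w c : ~~ trivial_word w -> c \in cuts w ->
  prec_cuts w c -> red_cuts w c.
Proof.
move=> tw cw /andP[t2 nf]; rewrite /red_cuts t2 andbT.
by apply: contra nf => t1; exact: first_nontrivial_low.
Qed.

Lemma succ_red_cuts w c : ~~ trivial_word w -> c \in cuts w ->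
  succ_cuts w c -> red_cuts w c.
Proof.
move=> tw cw /andP[t1 nf]; rewrite /red_cuts t1 /=.
by apply: contraL nf => t2; exact: first_nontrivial_up.
Qed.

(** The position test divides the reduced cuts in two. Each half-coproduct imposes one
    non-triviality condition, and the other follows from the test. *)
Lemma red_split u : cut_coprod red_cuts u
  = cut_coprod prec_cuts u + cut_coprod succ_cuts u :> vect K (TNC ⊠ TNC).
Proof.
move: u; apply: eq_linear => [||w].
- exact: cut_coprod_linear.
- by move=> a u v; rewrite !cut_coprod_linear scalerDr addrACA.
have [tw|tw] := boolP (trivial_word w).
  by rewrite red_cuts_trivial // prec_cuts_trivial // succ_cuts_trivial // addr0.
rewrite !cut_coprodU (bigID (fun c => prec_plus_cuts w c)).
congr (_ + _); apply: big_cuts_if => c cw.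
- apply/andP/idP => [[/andP[_ t2] pc]|pc]; first by rewrite /prec_cuts t2.
  by split; [exact: prec_red_cuts|case/andP: pc].
- apply/andP/idP => [[/andP[t1 _]]|sc]; first by rewrite /succ_cuts t1 negbK.
  by split; [exact: succ_red_cuts|case/andP: sc => _; rewrite negbK].
Qed.

Lemma dprec_plusU w : ~~ trivial_word w ->
  dprec_plus (A := TNCalg) one (@nc_prec K) (word w)
  = cut_coprod prec_plus_cuts (word w).
Proof. by move=> tw; rewrite /dprec_plus lin_extU nc_precE cut_coprod_prec_plus. Qed.

Lemma dsucc_plusU w :
  dsucc_plus (A := TNCalg) one (@nc_succ K) (word w)
  = cut_coprod succ_plus_cuts (word w).
Proof. by rewrite /dsucc_plus lin_extU nc_succE cut_coprod_succ_plus. Qed.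

Lemma offdiag_bilinear (V : lmodType K) (F G : vect K TNC -> vect K TNC -> V) p q :
  (forall v, linear (F^~ v)) -> (forall v, linear (G^~ v)) ->
  (forall u, linear (F u)) -> (forall u, linear (G u)) ->
  (forall a b, ~~ trivial_word a -> ~~ trivial_word b ->
     F (word a) (word b) = G (word a) (word b)) ->
  offdiag p -> offdiag q -> F p q = G p q.
Proof.
move=> Fl Gl Fr Gr FG op oq.
apply: (@eq_linear_supp _ _ _ (F^~ q) (G^~ q)) => // a ap.
apply: eq_linear_supp => // b bq.
by apply: FG; [exact: nontrivial_offdiag op ap|exact: nontrivial_offdiag oq bq].
Qed.

(** Let a, b, c be the first non-trivial positions of x, y, z. Both sides select a < b and a < c,
    with y and z non-trivial: only x attains the minimum. *)
Lemma nc_prec_prec u :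
  vassoc (vmap (@nc_prec K) id (nc_prec u)) = vmap id red (nc_prec u).
Proof.
rewrite (funext (@nc_precE K)) (funext (@red_coprodE K)); apply: cut_coprod_assoc => x y z sx sy /=.
rewrite /prec_cuts /red_cuts /prec_plus_cuts /= trivial_gap_inserts //.
rewrite !find_gap_inserts ?size_gap_inserts //.
by case: trivial_word; case: trivial_word; rewrite ?andbF ?andbT //=; lia.
Qed.

(** Both sides select b <= a and b < c, with x and z non-trivial: y is the last to attain the
    minimum. *)
Lemma nc_succ_prec u :
  vassoc (vmap (@nc_succ K) id (nc_prec u)) = vmap id (@nc_prec K) (nc_succ u).
Proof.
rewrite (funext (@nc_precE K)) (funext (@nc_succE K)); apply: cut_coprod_assoc => x y z sx sy /=.
rewrite /prec_cuts /succ_cuts /prec_plus_cuts /succ_plus_cuts /=.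
rewrite !find_gap_inserts ?size_gap_inserts //.
by case: trivial_word; case: trivial_word; rewrite ?andbF ?andbT //=; lia.
Qed.

(** Both sides select c <= a and c <= b, with x and y non-trivial: z attains the minimum. *)
Lemma nc_succ_succ u :
  vassoc (vmap red id (nc_succ u)) = vmap id (@nc_succ K) (nc_succ u).
Proof.
rewrite (funext (@nc_succE K)) (funext (@red_coprodE K)); apply: cut_coprod_assoc => x y z sx sy /=.
rewrite /succ_cuts /red_cuts /succ_plus_cuts /= trivial_gap_inserts //.
rewrite !find_gap_inserts ?size_gap_inserts //.
by case: trivial_word; case: trivial_word; rewrite ?andbF ?andbT //=; lia.
Qed.

Lemma nc_mul_closed (p q : vect K TNC) :
  offdiag p -> offdiag q -> offdiag (hmul TNCalg (p ⊗ q)).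
Proof.
move=> op oq; have lin_m := @hmul_words_linear K NC.
rewrite [p]malg_lin_ext hten_suml (linear_big lin_m).
apply: offdiag_sum => a ap; rewrite htenZl (linear_scale lin_m); apply: offdiagZ.
rewrite [q]malg_lin_ext hten_sumr (linear_big lin_m).
apply: offdiag_sum => b bq; rewrite htenZr (linear_scale lin_m); apply: offdiagZ.
rewrite hmul_wordsU => w; rewrite msuppU oner_eq0 inE => /eqP->.
by rewrite size_inw /trivial_word all_cat negb_and (nontrivial_offdiag op ap).
Qed.

(** Shared by ≺ and ≻: the first non-empty letter of a concatenation lies in the non-trivial left
    factor, so the full coproduct acts on the right one. *)
Lemma half_plus_mul (P : seq ncpart -> pred (seq ncpart * seq ncpart))
    (dplus : vect K TNC -> vect K (TNC ⊠ TNC)) p q :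
  linear dplus ->
  (forall w, ~~ trivial_word w -> dplus (word w) = cut_coprod P (word w)) ->
  (forall a b c d, ~~ trivial_word a -> c \in cuts a -> d \in cuts b ->
     P (a ++ b) (cat2 c d) = P a c) ->
  offdiag p -> offdiag q ->
  dplus (hmul TNCalg (p ⊗ q)) = vmul (dplus p ⊗ Delta q).
Proof.
move=> lin_d dE PE.
apply: (@offdiag_bilinear _ (fun p q => dplus (hmul TNCalg (p ⊗ q)))
  (fun p q => vmul (dplus p ⊗ Delta q))).
- move=> v; apply: (linear_comp lin_d).
  by apply: (linear_comp (@hmul_words_linear K NC)); exact: hten_linearl.
- move=> v; apply: (linear_comp (@hmul_vprod_linear K TNCalg TNCalg)).
  by apply: (@linear_comp _ _ _ _ (fun u => u ⊗ _) dplus) => //; exact: hten_linearl.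
- move=> u; apply: (linear_comp lin_d).
  by apply: (linear_comp (@hmul_words_linear K NC)); exact: hten_linearr.
- move=> u; apply: (linear_comp (@hmul_vprod_linear K TNCalg TNCalg)).
  by apply: linear_comp; [exact: hten_linearr|exact: lin_ext_is_linear].
move=> a b ta tb; rewrite hmul_wordsU (dE a ta) nc_coprodE dE; last first.
  by rewrite /trivial_word all_cat negb_and ta.
apply: cut_coprod_mul => c d cP dP; rewrite andbT; exact: PE.
Qed.

Lemma half_plus_one (P : seq ncpart -> pred (seq ncpart * seq ncpart))
    (dplus : vect K TNC -> vect K (TNC ⊠ TNC)) r q :
  linear dplus ->
  (forall w, ~~ trivial_word w -> dplus (word w) = cut_coprod P (word w)) ->
  (forall n b c d, c \in cuts (nseq n nc0) ->
     P (nseq n nc0 ++ b) (cat2 c d) = P b d) ->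
  offdiag q ->
  dplus (hmul TNCalg (one r ⊗ q)) = vmul ((one r ⊠ one r) ⊗ dplus q).
Proof.
move=> lin_d dE PE oq.
apply: (@eq_linear_supp _ _ _ (fun q => dplus (hmul TNCalg (one r ⊗ q)))
  (fun q => vmul ((one r ⊠ one r) ⊗ dplus q))).
- apply: (linear_comp lin_d).
  by apply: (linear_comp (@hmul_words_linear K NC)); exact: hten_linearr.
- apply: (linear_comp (@hmul_vprod_linear K TNCalg TNCalg)).
  by apply: linear_comp => //; exact: hten_linearr.
move=> b /(nontrivial_offdiag oq) tb; rewrite hmul_wordsU (dE b tb) dE; last first.
  by rewrite /trivial_word all_cat negb_and tb orbT.
rewrite -cut_coprod_nseq; apply: cut_coprod_mul => c d cP dP.
exact: PE.
Qed.

Lemma nc_unshuffle :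
  is_unshuffle (A := TNCalg) Delta eps one (@nc_prec K) (@nc_succ K).
Proof.
have prec_linear : linear (dprec_plus (A := TNCalg) one (@nc_prec K)).
  exact: lin_ext_is_linear.
have succ_linear : linear (dsucc_plus (A := TNCalg) one (@nc_succ K)).
  exact: lin_ext_is_linear.
split.
- exact: nc_conilpotent.
- exact: half_coprod (@nc_precE K) (@prec_cuts_trivial K) prec_red_cuts.
- exact: half_coprod (@nc_succE K) (@succ_cuts_trivial K) succ_red_cuts.
- by move=> u _; rewrite red_coprodE nc_precE nc_succE; exact: red_split.
- by move=> u _; exact: nc_prec_prec.
- by move=> u _; exact: nc_succ_prec.
- by move=> u _; exact: nc_succ_succ.
- exact: nc_mul_closed.
- exact: nc_coprod_mul.
- move=> p q; apply: (half_plus_mul prec_linear dprec_plusU) => a b c d ta cP dP.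
  by rewrite /prec_plus_cuts first_nontrivial_cat2.
- move=> p q; apply: (@half_plus_mul succ_plus_cuts _ _ _ succ_linear) => [w _|a b c d ta cP dP].
    exact: dsucc_plusU.
  by rewrite /succ_plus_cuts first_nontrivial_cat2.
- move=> r q oq; refine (@half_plus_one prec_plus_cuts _ r q prec_linear dprec_plusU _ oq) => n b c d cP.
  by rewrite /prec_plus_cuts first_nontrivial_nseq_cat2.
- move=> r q oq; refine (@half_plus_one succ_plus_cuts _ r q succ_linear
    (fun w _ => dsucc_plusU w) _ oq) => n b c d cP.
  by rewrite /succ_plus_cuts first_nontrivial_nseq_cat2.
Qed.

End Hopf.

Theorem proposition27 (R : realType) :
  exists S : vect R[i] (words NC) -> vect R[i] (words NC),
    is_unshuffle_hopf (A := words_alg R[i] NC)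
      (@nc_coprod R[i]) (@nc_counit R[i]) (@nc_one R[i])
      (@nc_prec R[i]) (@nc_succ R[i])
      (@nc_nabla R[i]) (@nc_eta R[i]) S.
Proof.
exists (@nc_antipode R[i]); split; first exact: nc_hopf.
exact: nc_unshuffle.
Qed.
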